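(* Let $g$ and $\bar g$ be geodesically equivalent pseudo-Riemannian metrics on a manifold $M$ of dimension $n$, let $L=L(g,\bar g)$ be the $(1,1)$-tensor associated with them, and let $\chi=\chi_1\cdot\chi_2$ be an admissible factorisation of the characteristic polynomial of $L$, with $\deg\chi_1=r$. Put $D_i=\ker\chi_i(L)$, $i=1,2$. Let $(x^1,\dots,x^r,y^{r+1},\dots,y^n)$ be a local coordinate system such that $D_1$ is generated by $\partial_{x^1},\dots,\partial_{x^r}$ and $D_2$ is generated by $\partial_{y^{r+1}},\dots,\partial_{y^n}$, so that in these coordinates the matrix of $L$ is block-diagonal, $$L(x,y)=\begin{pmatrix}L_1(x,y)&0\\0&L_2(x,y)\end{pmatrix},$$ with $L_1$ an $r\times r$ matrix and $L_2$ an $(n-r)\times(n-r)$ matrix. Then the entries of $L_1$ depend on the $x$-variables only and the entries of $L_2$ depend on the $y$-variables only, i.e. $$L(x,y)=\begin{pmatrix}L_1(x)&0\\0&L_2(y)\end{pmatrix}.$$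
   Context: Two Riemannian or pseudo-Riemannian metrics $g,\bar g$ on the same manifold $M^n$ are geodesically equivalent if they have the same geodesics considered as unparametrized curves. The tensor $L=L(g,\bar g)$ is $$L^i_j=\left(\frac{\det \bar g}{\det g}\right)^{\frac1{n+1}}\bar g^{ik}g_{kj},$$ where, replacing $g$ by $-g$ if necessary, one assumes that this expression is well defined. The characteristic polynomial is $\chi(t)=\det(t\cdot\mathrm{Id}-L)$. A factorisation $\chi(t)=\chi_1(t)\chi_2(t)$ into two monic real polynomials of degree $\ge 1$ (with coefficients that are smooth functions on $M$) is admissible if $\chi_1$ and $\chi_2$ are coprime (have no common complex roots) at every point of $M$. For a polynomial $p(t)=\sum_k a_k t^k$ with coefficients functions on $M$, $p(L)=\sum_k a_kL^k$. The distributions $D_1,D_2$ are $L$-invariant, transversal, of complementary dimensions $r$ and $n-r$, and are integrable; a coordinate system as in the claim exists near every point. *)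

(* Defs.v *)
From HB Require Import structures.
From mathcomp Require Import all_boot all_order all_algebra.
From mathcomp Require Import complex.
From mathcomp Require Import all_classical all_reals all_analysis.

Set Implicit Arguments.
Unset Strict Implicit.
Unset Printing Implicit Defensive.

Import Order.TTheory GRing.Theory Num.Theory.
Import numFieldNormedType.Exports.

Local Open Scope classical_set_scope.
Local Open Scope ring_scope.

Section Smoothness.
Variables (R : realType) (n : nat).

Definition partial (i : 'I_n) (f : 'rV[R]_n -> R) : 'rV[R]_n -> R :=
  fun x => 'D_(delta_mx 0 i) f x.

(* Meant for open U: the values of f outside U are then irrelevant. *)
Fixpoint Ck (k : nat) (U : set 'rV[R]_n) (f : 'rV[R]_n -> R) : Prop :=
  (forall x, U x -> {for x, continuous f}) /\
  match k with
  | 0 => True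
  | k'.+1 => forall i : 'I_n,
      (forall x, U x -> derivable f x (delta_mx 0 i)) /\ Ck k' U (partial i f)
  end.

Definition smooth (U : set 'rV[R]_n) (f : 'rV[R]_n -> R) : Prop :=
  forall k, Ck k U f.

End Smoothness.

Section Manifolds.
Variables (R : realType) (n : nat) (M : topologicalType).

(* [chart_map] and [chart_inv] are total functions, meaningful only on
   [chart_dom] and [chart_im] respectively. *)
Record chart := Chart {
  chart_dom : set M;
  chart_map :> M -> 'rV[R]_n;
  chart_inv : 'rV[R]_n -> M;
  chart_dom_open : open chart_dom;
  chart_im_open : open (chart_map @` chart_dom);
  chart_mapK : forall p, chart_dom p -> chart_inv (chart_map p) = p;
  chart_map_continuous :
    forall p, chart_dom p -> {for p, continuous chart_map};
  chart_inv_continuous :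
    forall x, (chart_map @` chart_dom) x -> {for x, continuous chart_inv}
}.

Definition chart_im (c : chart) : set 'rV[R]_n := c @` chart_dom c.

Definition transition (c c' : chart) (k : 'I_n) : 'rV[R]_n -> R :=
  fun x => c' (chart_inv c x) 0 k.

Definition smooth_transition (c c' : chart) : Prop :=
  forall k, smooth (c @` (chart_dom c `&` chart_dom c')) (transition c c' k).

Record smooth_structure := SmoothStructure {
  atlas : set chart;
  atlas_cover : forall p, exists2 c, atlas c & chart_dom c p;
  atlas_compat : forall c c', atlas c -> atlas c' -> smooth_transition c c';
  manifold_hausdorff : hausdorff_space M;
  manifold_second_countable : @second_countable M
}.

Variable S : smooth_structure.

(* Membership in the maximal atlas. *)
Definition coordinate_system (c : chart) : Prop :=
  forall c', atlas S c' -> smooth_transition c c' /\ smooth_transition c' c.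

Definition smooth_on_manifold (f : M -> R) : Prop :=
  forall c, coordinate_system c -> smooth (chart_im c) (f \o chart_inv c).

Definition jacobian (c c' : chart) (x : 'rV[R]_n) : 'M[R]_n :=
  \matrix_(k, i) partial i (transition c c' k) x.

(* A metric is given by its components: [g c x i j] is g_ij at the point with
   coordinates x in the coordinate system c. *)
Record metric := Metric {
  components :> chart -> 'rV[R]_n -> 'M[R]_n;
  metric_smooth : forall c, coordinate_system c ->
    forall i j, smooth (chart_im c) (fun x => components c x i j);
  metric_sym : forall c, coordinate_system c ->
    forall x, chart_im c x -> (components c x)^T = components c x;
  metric_nondeg : forall c, coordinate_system c ->
    forall x, chart_im c x -> components c x \in unitmx;
  metric_tensorial : forall c c', coordinate_system c ->
    coordinate_system c' -> forall p, chart_dom c p -> chart_dom c' p ->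
    components c (c p) =
      (jacobian c c' (c p))^T *m components c' (c' p) *m jacobian c c' (c p)
}.

(* Gamma^k_ij of the coordinate expression G of a metric. *)
Definition christoffel (G : 'rV[R]_n -> 'M[R]_n) (k i j : 'I_n)
    (x : 'rV[R]_n) : R :=
  2^-1 * \sum_(l < n) invmx (G x) k l *
    (partial i (fun y => G y j l) x + partial j (fun y => G y i l) x
     - partial l (fun y => G y i j) x).

Definition open_interval (I : set R) : Prop := open I /\ is_interval I.

(* Affinely parametrised geodesics on I. *)
Definition geodesic (g : metric) (I : set R) (gamma : R -> M) : Prop :=
  (forall t, I t -> {for t, continuous gamma}) /\
  forall t, I t -> forall c, coordinate_system c -> chart_dom c (gamma t) ->
    let x k := fun s : R => c (gamma s) 0 k in
    forall k : 'I_n,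
      [/\ derivable (x k) t 1, derivable (derive1 (x k)) t 1 &
          derive1 (derive1 (x k)) t +
          \sum_(i < n) \sum_(j < n) christoffel (g c) k i j (c (gamma t)) *
             derive1 (x i) t * derive1 (x j) t = 0].

(* tau is a diffeomorphism of J onto I. *)
Definition reparametrisation (J I : set R) (tau : R -> R) : Prop :=
  set_bij J I tau /\
  forall s, J s ->
    (forall k, derivable (derive1n k tau) s 1) /\ derive1 tau s != 0.

Definition geodesics_among (g h : metric) : Prop :=
  forall (I : set R) (gamma : R -> M), open_interval I -> geodesic g I gamma ->
    exists (J : set R) (tau : R -> R),
      [/\ open_interval J, reparametrisation J I tau &
          geodesic h J (gamma \o tau)].

Definition geodesically_equivalent (g h : metric) : Prop :=
  geodesics_among g h /\ geodesics_among h g.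

End Manifolds.

(* The real m-th root of x, for odd m or for x >= 0. *)
Definition real_root (R : realType) (m : nat) (x : R) : R :=
  Num.sg x * `|x| `^ (m%:R^-1).

(* p(A) = \sum_k p_k A^k; [horner_mx] would require a size of the form m.+1. *)
Definition poly_mx (R : realType) (n : nat) (p : {poly R}) (A : 'M[R]_n) :
    'M[R]_n :=
  \sum_(k < size p) p`_k *: A ^+ k.

Section AssociatedTensor.
Variables (R : realType) (n : nat) (M : topologicalType).
Variables (S : smooth_structure R n M) (g h : metric S).

(* Condition for the (n+1)-st root in L(g,h) to be a real root: only for odd n
   is there a sign condition, and only then does g |-> -g change the sign. *)
Definition associated_tensor_defined : Prop :=
  odd n -> forall c, coordinate_system S c ->
    forall x, chart_im c x -> 0 < \det (h c x) / \det (g c x).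

(* The matrix (L^i_j) of L(g,h) in the coordinate system c; row index i. *)
Definition associated_tensor (c : chart R n M) (x : 'rV[R]_n) : 'M[R]_n :=
  real_root n.+1 (\det (h c x) / \det (g c x)) *: (invmx (h c x) *m g c x).

Definition smooth_monic_family (chi : M -> {poly R}) (d : nat) : Prop :=
  (forall p, chi p \is monic /\ size (chi p) = d.+1) /\
  forall k, smooth_on_manifold S (fun p => (chi p)`_k).

Definition admissible_factorisation (chi1 chi2 : M -> {poly R}) (r : nat) :
    Prop :=
  [/\ (0 < r < n)%N,
      smooth_monic_family chi1 r /\ smooth_monic_family chi2 (n - r),
      forall c, coordinate_system S c -> forall p, chart_dom c p ->
        char_poly (associated_tensor c (c p)) = chi1 p * chi2 p &
      forall p (z : complex R),
        ~ (root (map_poly (real_complex R) (chi1 p)) z /\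
           root (map_poly (real_complex R) (chi2 p)) z)].

(* ker chi(L) at the point with coordinates x, in components w.r.t. the
   coordinate frame of c. *)
Definition kernel_distribution (chi : M -> {poly R}) (c : chart R n M)
    (x : 'rV[R]_n) : set 'cV[R]_n :=
  [set v | poly_mx (chi (chart_inv c x)) (associated_tensor c x) *m v = 0].

End AssociatedTensor.

Section Coordinates.
Variables (R : realType) (n : nat).

(* The span of the coordinate vectors d/dx^i with P i. *)
Definition coordinate_span (P : pred 'I_n) : set 'cV[R]_n :=
  [set v | exists a : 'I_n -> R, v = \sum_(i < n | P i) a i *: delta_mx i 0].

(* f does not change along connected subsets of V on which the coordinates in P
   are constant.  Connectedness can be dropped when the slices of V are
   connected, e.g. when V is a box; it cannot for general V, where even a
   function whose other partial derivatives vanish may take different values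
   on two components of one slice. *)
Definition depends_only_on (P : pred 'I_n) (V : set 'rV[R]_n)
    (f : 'rV[R]_n -> R) : Prop :=
  forall C : set 'rV[R]_n, C `<=` V -> connected C ->
    (forall x y, C x -> C y -> forall k, P k -> x 0 k = y 0 k) ->
    forall x y, C x -> C y -> f x = f y.

End Coordinates.

(* Main.v *)
Require Import Defs.
From HB Require Import structures.
From mathcomp Require Import all_boot all_order all_algebra.
From mathcomp Require Import fingroup perm.
From mathcomp Require Import complex.
From mathcomp Require Import all_classical all_reals all_analysis.
From mathcomp Require Import ring lra.
Import Order.TTheory GRing.Theory Num.Theory.
Import numFieldNormedType.Exports.
Local Open Scope classical_set_scope.
Local Open Scope ring_scope.

Set Implicit Arguments.
Unset Strict Implicit.
Unset Printing Implicit Defensive.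

(** Why the theorem is true.  The point of geodesic equivalence is that it makes
    the Nijenhuis torsion of L vanish; the splitting of L is then linear algebra.

    Geodesics enter only through one infinitesimal fact, due to Weyl: the
    Christoffel symbols of g and gbar differ by
    delta^k_i phi_j + delta^k_j phi_i for some covector phi at each point
    ([weyl]).  To see it, take a point a and a vector u and a g-geodesic through
    a with velocity u ([geodesic_exists]).  Reparametrised, it is a
    gbar-geodesic; subtracting the two geodesic equations at a shows that the
    difference D of the Christoffel symbols satisfies D(u,u) parallel to u
    ([christoffel_difference_parallel]).  As this holds for all u,
    polarisation gives the formula for D ([symmetric_projective]).

    The existence of the geodesic is Picard's theorem ([ode_local]) in the given
    coordinate system.  A geodesic has to satisfy its equation in every
    coordinate system, so the equation must be shown to be covariant.  This is
    cleaner for the Euler-Lagrange form of the equation, which is the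
    Christoffel form multiplied by the metric
    ([christoffel_euler_lagrange]): under a change of coordinates with jacobian
    J the Euler-Lagrange covector is multiplied by J^T, the second derivatives
    of the transition dropping out by their symmetry
    ([euler_lagrange_pullback]).

    Weyl's formula and the metric property of the Levi-Civita connections of g
    and gbar determine the derivative of L: its covariant derivative along u is
    the rank two operator - u (phi L) - w (u^T g) with a vector w independent of
    u ([is_derive_projective_tensor]).  The factor (det gbar / det g)^(1/(n+1))
    in L is what cancels the terms phi(u) L here.  Since L is g-selfadjoint, the
    torsion of L is zero ([nijenhuis]).

    Let finally D_1 and D_2 be spanned by the coordinates x and y.  They are
    the kernels of chi_1(L) and chi_2(L), hence L-invariant, and L is
    block-diagonal.  For a fixed coordinate x_i, the derivatives of the i-th
    column of L_1 along the y-directions form an operator X which maps D_2 to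
    D_1 and kills D_1; the torsion of L evaluated on d/dx_i and d/dy_b says
    that L X = X L.  Then chi_2(L) X = X chi_2(L) = 0, so the image of X lies in
    both D_1 and D_2 and X = 0 ([sylvester_zero]).  The same argument with
    the two distributions exchanged applies to L_2
    ([associated_tensor_splits]). *)

(** * Directional derivatives *)

Lemma is_derive_eqfun (R : numFieldType) (V W : normedModType R)
    (f g : V -> W) (x v : V) (df : W) :
  is_derive x v f df -> f =1 g -> is_derive x v g df.
Proof. by move=> hf /funext <-. Qed.

Section PointwiseDerivatives.
Variables (R : realType) (V : normedModType R).
Implicit Types (f g : V -> R) (x v : V).

Lemma is_derive_add f g x v df dg : is_derive x v f df -> is_derive x v g dg ->
  is_derive x v (fun y => f y + g y) (df + dg).
Proof. by move=> hf hg; exact: is_deriveD. Qed.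

Lemma is_derive_opp f x v df : is_derive x v f df ->
  is_derive x v (fun y => - f y) (- df).
Proof. by move=> hf; exact: is_deriveN. Qed.

Lemma is_derive_sub f g x v df dg : is_derive x v f df -> is_derive x v g dg ->
  is_derive x v (fun y => f y - g y) (df - dg).
Proof. by move=> hf hg; exact: is_deriveB. Qed.

Lemma is_derive_mul f g x v df dg : is_derive x v f df -> is_derive x v g dg ->
  is_derive x v (fun y => f y * g y) (df * g x + f x * dg).
Proof.
move=> hf hg; have h := is_deriveM hf hg.
apply: is_derive_eq h _.
by rewrite addrC /GRing.scale /= (mulrC (g x)).
Qed.

Lemma is_derive_inv f x v df : is_derive x v f df -> f x != 0 ->
  is_derive x v (fun y => (f y)^-1) (- (df / f x ^+ 2)).
Proof.
move=> hf f0; case: hf => hf <-; apply: DeriveDef; first exact: derivableV.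
by rewrite (deriveV f0 hf) /GRing.scale /= mulrC mulrN.
Qed.

Lemma is_derive_bigsum (I : Type) (r : seq I) (P : pred I) (F : I -> V -> R)
    (dF : I -> R) x v :
  (forall i, P i -> is_derive x v (F i) (dF i)) ->
  is_derive x v (fun y => \sum_(i <- r | P i) F i y) (\sum_(i <- r | P i) dF i).
Proof.
move=> h; elim: r => [|a r IH].
  rewrite big_nil; apply: is_derive_eqfun (is_derive_cst 0 x v) _.
  by move=> y; rewrite big_nil.
rewrite big_cons; case: ifPn => Pa.
  apply: is_derive_eqfun (is_derive_add (h a Pa) IH) _.
  by move=> y; rewrite big_cons Pa.
by apply: is_derive_eqfun IH _ => y; rewrite big_cons (negbTE Pa).
Qed.

End PointwiseDerivatives.

Section MatrixDerivatives.
Variables (R : realType) (V : normedModType R).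

Lemma is_derive_mxP m n (A : V -> 'M[R]_(m, n)) x v (dA : 'M[R]_(m, n)) :
  is_derive x v A dA <->
  forall i j, is_derive x v (fun y => A y i j) (dA i j).
Proof.
split=> [[hA <-] i j|h].
  apply: DeriveDef; first by move/derivable_mxP: hA.
  by rewrite derive_mx // mxE.
have hA : derivable A x v by apply/derivable_mxP => i j; have [] := h i j.
apply: DeriveDef => //; rewrite derive_mx //; apply/matrixP => i j.
by rewrite mxE; have [_ ->] := h i j.
Qed.

Lemma is_derive_mulmx m n p (A : V -> 'M[R]_(m, n)) (B : V -> 'M[R]_(n, p))
    x v dA dB :
  is_derive x v A dA -> is_derive x v B dB ->
  is_derive x v (fun y => A y *m B y) (dA *m B x + A x *m dB).
Proof.
move=> /is_derive_mxP hA /is_derive_mxP hB; apply/is_derive_mxP => i j.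
rewrite !mxE -big_split /=.
apply: (@is_derive_eqfun _ _ _ (fun y => \sum_k A y i k * B y k j)); last first.
  by move=> y; rewrite mxE.
by apply: is_derive_bigsum => k _; exact: is_derive_mul.
Qed.

Lemma is_derive_trmx m n (A : V -> 'M[R]_(m, n)) x v dA :
  is_derive x v A dA -> is_derive x v (fun y => (A y)^T) dA^T.
Proof.
move=> /is_derive_mxP hA; apply/is_derive_mxP => i j; rewrite mxE.
by apply: is_derive_eqfun (hA j i) _ => y; rewrite mxE.
Qed.

Lemma is_derive_scalemx m n (a : V -> R) (A : V -> 'M[R]_(m, n)) x v da dA :
  is_derive x v a da -> is_derive x v A dA ->
  is_derive x v (fun y => a y *: A y) (da *: A x + a x *: dA).
Proof.
move=> ha /is_derive_mxP hA; apply/is_derive_mxP => i j; rewrite !mxE.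
by apply: is_derive_eqfun (is_derive_mul ha (hA i j)) _ => y; rewrite mxE.
Qed.

End MatrixDerivatives.

Section Lines.
Variables (R : realType) (V : normedModType R).
Implicit Types (f : V -> R) (x v : V).

(** Reduces derivatives along a line in V to derivatives of functions on the real
    line, for which the mean value theorem is available. *)
Lemma is_derive_line f x v (t : R) : derivable f (x + t *: v) v ->
  is_derive t 1 (fun s : R => f (x + s *: v)) ('D_v f (x + t *: v)).
Proof.
move=> hf.
have E : (fun h : R => h^-1 *: ((fun s : R => f (x + s *: v)) (h *: (1 : R) + t)
    - f (x + t *: v))) =
  (fun h => h^-1 *: (f (h *: v + (x + t *: v)) - f (x + t *: v))).
  apply/funext => h; congr (_ *: (f _ - _)).
  by rewrite [h *: 1]mulr1 scalerDl addrCA.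
apply: DeriveDef; first by rewrite /derivable /= E.
by rewrite /derive /= E.
Qed.

(** The displacement is h v rather than v so that steps of either sign along a
    fixed coordinate vector are covered, with the derivative along that vector. *)
Lemma mvt_line f x v (h : R) :
  (forall t : R, 0 <= t <= 1 -> derivable f (x + (t * h) *: v) v) ->
  exists2 t : R, 0 <= t <= 1 &
    f (x + h *: v) - f x = h * 'D_v f (x + (t * h) *: v).
Proof.
move=> hf.
have hd (t : R) : 0 <= t <= 1 -> is_derive t 1 (fun s : R => f (x + (s * h) *: v))
    ('D_v f (x + (t * h) *: v) * h).
  move=> /hf /is_derive_line d1.
  have d2 : is_derive t (1 : R) (fun s : R => s * h) h.
    apply: is_derive_eq (is_derive_mul (is_derive_id _ _) (is_derive_cst h _ _)) _.
    by rewrite mul1r mulr0 addr0.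
  exact: (@is_derive1_comp _ (fun s => f (x + s *: v)) (fun s => s * h)).
have [||c] := @MVT_segment R (fun s : R => f (x + (s * h) *: v))
    (fun t => 'D_v f (x + (t * h) *: v) * h) 0 1 ler01.
- by move=> t; rewrite in_itv /= => /andP[t0 t1]; apply: hd; rewrite !ltW.
- apply: derivable_within_continuous => t; rewrite in_itv /= => t01.
  by have [] := hd t t01.
rewrite in_itv /= => c01; rewrite mul1r mul0r scale0r addr0 => ->.
by exists c => //; rewrite subr0 mulr1 mulrC.
Qed.

End Lines.

Lemma continuous_bigsum (R : realType) (T : topologicalType) (I : Type)
    (r : seq I) (P : pred I) (F : I -> T -> R) x :
  (forall i, P i -> {for x, continuous (F i)}) ->
  {for x, continuous (fun y => \sum_(i <- r | P i) F i y)}.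
Proof.
move=> h; elim: r => [|a r IH].
  rewrite (_ : (fun _ => _) = cst 0); first exact: cvg_cst.
  by apply/funext => y; rewrite big_nil.
have [Pa|Pa] := boolP (P a); last first.
  rewrite (_ : (fun _ => _) = (fun y => \sum_(i <- r | P i) F i y)) //.
  by apply/funext => y; rewrite big_cons (negbTE Pa).
rewrite (_ : (fun _ => _) = (fun y => F a y + \sum_(i <- r | P i) F i y)).
  by apply: continuousD => //; exact: h.
by apply/funext => y; rewrite big_cons Pa.
Qed.

Lemma nbhs_forall (T : topologicalType) (I : finType) (P : I -> T -> Prop) (x : T) :
  (forall i, nbhs x (P i)) -> nbhs x (fun y => forall i, P i y).
Proof. exact: filter_forall. Qed.

(** * Functions with continuous partial derivatives *)

Section Partials.
Variables (R : realType) (n : nat).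
Implicit Types (f g : 'rV[R]_n -> R) (U : set 'rV[R]_n) (x v : 'rV[R]_n).
Local Notation e_ i := (delta_mx 0 i : 'rV[R]_n).

Lemma coord_le_norm x i : `|x 0 i| <= `|x|.
Proof.
by rewrite [leRHS]/Num.norm /= mx_normrE; apply: (le_bigmax _ _ (0, i)).
Qed.

Lemma norm_le_coord x (B : R) : 0 <= B -> (forall i, `|x 0 i| <= B) -> `|x| <= B.
Proof.
move=> B0 h; rewrite [leLHS]/Num.norm /= mx_normrE; apply: bigmax_le => //.
by move=> [i j] _ /=; rewrite ord1.
Qed.

Lemma nbhs_ball_le x (P : set 'rV[R]_n) : nbhs x P ->
  exists2 d : R, 0 < d & forall y, `|y - x| <= d -> P y.
Proof.
move=> /nbhs_ballP[d /= d0 hd]; exists (d / 2); first by rewrite divr_gt0.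
move=> y hy; apply: hd; rewrite -ball_normE /= distrC.
by rewrite (le_lt_trans hy) // ltr_pdivrMr // ltr_pMr // ltr1n.
Qed.

Let first_coords (m : nat) (h : 'rV[R]_n) : 'rV[R]_n :=
  \row_(k < n) if (k < m)%N then h 0 k else 0.

Let first_coordsS (i : 'I_n) h : first_coords i.+1 h = first_coords i h + h 0 i *: e_ i.
Proof.
apply/rowP => k; rewrite !mxE eqxx /= ltnS leq_eqVlt.
have [->|ki] := eqVneq k i; first by rewrite eqxx ltnn /= add0r mulr1.
by rewrite (negbTE (_ : nat_of_ord k != i)) //= mulr0 addr0.
Qed.

(** Truncated displacements and the segments between consecutive ones stay in
    every sup-norm ball, so that the mean value theorem applies coordinate by
    coordinate. *)
Lemma partials_increment f a (d e : R) : 0 <= d ->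
  (forall i x, `|x - a| <= d -> derivable f x (e_ i)) ->
  (forall i x, `|x - a| <= d -> `|partial i f x - partial i f a| <= e) ->
  forall h, `|h| <= d ->
  `|f (a + h) - f a - \sum_i h 0 i * partial i f a| <= n%:R * e * `|h|.
Proof.
move=> d0 hder hpar h hd.
have trn : a + h = a + first_coords n h.
  by congr (_ + _); apply/rowP => k; rewrite mxE ltn_ord.
have tr0 : a = a + first_coords 0 h.
  by apply/rowP => k; rewrite !mxE ltn0 addr0.
have -> : f (a + h) - f a =
    \sum_(i < n) (f (a + first_coords i.+1 h) - f (a + first_coords i h)).
  rewrite -(big_mkord xpredT (fun i => f (a + first_coords i.+1 h) - f (a + first_coords i h))).
  by rewrite telescope_sumr // -trn -tr0.
rewrite -sumrB (le_trans (ler_norm_sum _ _ _)) //.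
have -> : n%:R * e * `|h| = \sum_(i < n) e * `|h|.
  by rewrite sumr_const card_ord -mulrA mulr_natl.
apply: ler_sum => i _.
have hin (t : R) : 0 <= t <= 1 ->
    `|a + first_coords i h + (t * h 0 i) *: e_ i - a| <= d.
  move=> /andP[t0 t1]; rewrite -[a + _ + _]addrA addrAC subrr add0r.
  apply: norm_le_coord => // k; rewrite !mxE eqxx /=.
  have [->|ki] := eqVneq k i.
    rewrite ltnn add0r mulr1 normrM (ger0_norm t0).
    apply: le_trans (_ : 1 * `|h 0 i| <= _); first by rewrite ler_wpM2r.
    by rewrite mul1r (le_trans (coord_le_norm _ _)).
  rewrite mulr0 addr0; case: ifP => _; last by rewrite normr0.
  by rewrite (le_trans (coord_le_norm _ _)).
have [t t01] := @mvt_line R _ f (a + first_coords i h) (e_ i) (h 0 i)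
  (fun t t01 => hder i _ (hin t t01)).
rewrite -addrA -first_coordsS => ->; rewrite -mulrBr normrM mulrC.
apply: ler_pM => //; last exact: coord_le_norm.
exact: hpar (hin t t01).
Qed.

Lemma continuous_near_le f a (e : R) : {for a, continuous f} -> 0 < e ->
  \forall y \near a, `|f y - f a| <= e.
Proof.
move=> /cvgrPdist_le h e0; have := h e e0.
by apply: filterS => y; rewrite distrC; apply.
Qed.

Lemma CkW k U f : Ck k.+1 U f -> Ck k U f.
Proof.
elim: k f => [|k IH] f [hc hd]; split=> // i; have [h1 h2] := hd i.
by split=> //; exact: IH.
Qed.

Lemma Ck_continuous k U f x : Ck k U f -> U x -> {for x, continuous f}.
Proof. by case: k => [|k] [h _]; exact: h. Qed.

Lemma Ck_derivable k U f x i : Ck k.+1 U f -> U x -> derivable f x (e_ i).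
Proof. by move=> [_ h] Ux; have [h1 _] := h i; exact: h1. Qed.

Lemma Ck_partial k U f i : Ck k.+1 U f -> Ck k U (partial i f).
Proof. by move=> [_ h]; have [_] := h i. Qed.

Lemma C1_partials_near U f a (e : R) : open U -> Ck 1 U f -> U a -> 0 < e ->
  nbhs a (fun y => U y /\ forall i, `|partial i f y - partial i f a| <= e).
Proof.
move=> oU hf Ua e0; apply: filterI.
  exact: open_nbhs_nbhs.
apply: (@nbhs_forall _ _ (fun i y => `|partial i f y - partial i f a| <= e)).
by move=> i; apply: continuous_near_le e0; exact: Ck_continuous (Ck_partial i hf) Ua.
Qed.

Let lin_partials f a (h : 'rV[R]_n) : R := \sum_i h 0 i * partial i f a.

Let lin_partials_linear f a : linear (lin_partials f a).
Proof.
move=> k u v; rewrite /lin_partials /GRing.scale /= mulr_sumr -big_split /=.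
by apply: eq_bigr => i _; rewrite !mxE mulrDl mulrA.
Qed.

(** Continuity of the partial derivatives near a makes the error of the
    coordinatewise estimate [partials_increment] small compared with the
    displacement, so the linear form given by the partial derivatives is the
    differential. *)
Lemma C1_differentiable U f a : open U -> Ck 1 U f -> U a ->
  differentiable f a /\
  forall v, 'd f a v = \sum_i v 0 i * partial i f a.
Proof.
move=> oU hf Ua.
pose dM := GRing.isLinear.Build _ _ _ _ _ (lin_partials_linear f a).
pose dL : {linear 'rV[R]_n -> R} := HB.pack (lin_partials f a) dM.
have dLc : continuous dL.
  move=> x; apply: continuous_bigsum => i _.
  by apply: continuousM; [exact: coord_continuous|exact: cst_continuous].
have := @diff_unique _ _ _ f dL a dLc; set E := (X in (X -> _) -> _) => D.
have hE : E.
  rewrite /E; apply/eqaddoP => e e0.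
  have n0 : 0 < (n.+1%:R : R) by rewrite ltr0n.
  have /nbhs_ball_le[d d0 hd] := C1_partials_near oU hf Ua (divr_gt0 e0 n0).
  apply/nbhs_ballP; exists d => //= h.
  rewrite -ball_normE /= sub0r normrN => /ltW hh.
  have := @partials_increment f a d (e / n.+1%:R) (ltW d0)
    (fun i x hx => Ck_derivable hf (hd x hx).1)
    (fun i x hx => (hd x hx).2 i) h hh.
  rewrite -[X in _ -> `|X| <= _]/(f (h + a) - (f a + lin_partials f a h)).
  rewrite (addrC h) opprD addrA; move/le_trans; apply.
  rewrite ler_wpM2r // mulrCA ler_piMr //; first exact: ltW.
  by rewrite ler_pdivrMr // mul1r ler_nat.
split; last by move=> v; rewrite (D hE).
by apply/diff_locallyP; rewrite (D hE).
Qed.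

End Partials.

Section Chain.
Variables (R : realType) (n : nat).

(** Every directional derivative is a derivative of a function on the real line;
    this transfers the chain rule to directional derivatives. *)
Lemma is_derive_at0 (V W : normedModType R) (f : V -> W) x v df :
  is_derive x v f df <->
  is_derive (0 : R) 1 (fun h : R => f (h *: v + x)) df.
Proof.
have E : 'D_v f x = 'D_1 (fun h : R => f (h *: v + x)) 0.
  rewrite /derive; set F := (X in X @ _); set G := (X in _ = lim (X @ _)).
  suff -> : F = G by []; apply/funext => h; rewrite /F /G /=.
  by rewrite addr0 scale0r add0r [h%:A]mulr1.
split=> [[h1 h2]|[h1 h2]]; apply: DeriveDef; rewrite -?h2 ?E //.
  exact: (proj1 (derivable1P f x v) h1).
exact: (proj2 (derivable1P f x v) h1).
Qed.

Lemma is_derive_comp_diff (V : normedModType R) (f : 'rV[R]_n -> R)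
    (c : V -> 'rV[R]_n) t v dc :
  differentiable f (c t) -> is_derive t v c dc ->
  is_derive t v (fun s => f (c s)) ('d f (c t) dc).
Proof.
move=> df /is_derive_at0 [hc <-]; apply/is_derive_at0.
have dc1 : differentiable (fun h : R => c (h *: v + t)) 0.
  exact/derivable1_diffP.
have E0 : c t = c (0 *: v + t) by rewrite scale0r add0r.
have df' : differentiable f ((fun h : R => c (h *: v + t)) 0) by rewrite -E0.
have dfc : differentiable (f \o (fun h : R => c (h *: v + t))) 0.
  exact: differentiable_comp.
apply: DeriveDef; first exact/derivable1_diffP.
by rewrite (deriveE _ dfc) diff_comp // /= -E0 (deriveE _ dc1).
Qed.

End Chain.

Lemma continuous_near_eq (T W : topologicalType) (f g : T -> W) (x : T) :
  (\forall y \near x, f y = g y) -> {for x, continuous f} -> {for x, continuous g}.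
Proof.
move=> fg hf; rewrite /prop_for /continuous_at -(nbhs_singleton fg).
by apply: cvg_trans hf; exact: near_eq_cvg.
Qed.

Lemma continuous_eqfun (T W : topologicalType) (f g : T -> W) (x : T) :
  f =1 g -> {for x, continuous f} -> {for x, continuous g}.
Proof. by move=> /funext ->. Qed.

Section CkClosure.
Variables (R : realType) (n : nat).
Implicit Types (f g : 'rV[R]_n -> R) (U : set 'rV[R]_n) (x v : 'rV[R]_n).
Local Notation e_ i := (delta_mx 0 i : 'rV[R]_n).

Lemma Ck_is_derive k U f x i : Ck k.+1 U f -> U x ->
  is_derive x (e_ i) f (partial i f x).
Proof. by move=> hf Ux; apply: DeriveDef => //; exact: Ck_derivable hf Ux. Qed.

Lemma open_near U x (P : 'rV[R]_n -> Prop) : open U -> U x ->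
  (forall y, U y -> P y) -> \forall y \near x, P y.
Proof. by move=> oU Ux h; apply: filterS h _; exact: open_nbhs_nbhs. Qed.

(** The predicate Ck on an open set is local: partial derivatives only see the
    values of the function near the point.  This is what allows the formulas for
    derivatives of sums, products and so on, valid on U only, to be used. *)
Lemma Ck_ext k U f g : open U -> (forall x, U x -> f x = g x) ->
  Ck k U f -> Ck k U g.
Proof.
move=> oU; elim: k f g => [|k IH] f g fg [hc hd].
  split=> // x Ux; apply: continuous_near_eq (hc x Ux).
  exact: (open_near oU Ux).
have fgn x : U x -> \near x, f x = g x by move=> Ux; exact: (open_near oU Ux).
split=> [x Ux|i]; first exact: continuous_near_eq (fgn x Ux) (hc x Ux).
have [h1 h2] := hd i; split=> [x Ux|].
  by apply: near_eq_derivable (h1 x Ux); exact: fgn.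
by apply: IH h2 => x Ux; apply: near_eq_derive; exact: fgn.
Qed.

Lemma CkI k U f (df : 'I_n -> 'rV[R]_n -> R) : open U ->
  (forall x, U x -> {for x, continuous f}) ->
  (forall i x, U x -> is_derive x (e_ i) f (df i x)) ->
  (forall i, Ck k U (df i)) -> Ck k.+1 U f.
Proof.
move=> oU hc hd hk; split=> // i.
split=> [x Ux|]; first by have [] := hd i x Ux.
by apply: Ck_ext (hk i) => // x Ux; have [_] := hd i x Ux.
Qed.

Lemma Ck_cst k U (c : R) : open U -> Ck k U (fun=> c).
Proof.
move=> oU; elim: k c => [|k IH] c; first by split=> // x _; exact: cst_continuous.
apply: (CkI (df := fun _ _ => 0)) => // x _.
exact: cst_continuous.
Qed.

Lemma Ck_coord k U (j : 'I_n) : open U -> Ck k U (fun x => x 0 j).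
Proof.
move=> oU; case: k => [|k]; first by split=> // x _; exact: coord_continuous.
apply: (CkI (df := fun i _ => (e_ i) 0 j)) => // [x _|i x _|i].
- exact: coord_continuous.
- by have /is_derive_mxP := is_derive_id x (e_ i).
- exact: Ck_cst.
Qed.

Lemma Ck_add k U f g : open U -> Ck k U f -> Ck k U g ->
  Ck k U (fun x => f x + g x).
Proof.
move=> oU; elim: k f g => [|k IH] f g hf hg.
  by split=> // x Ux; apply: continuousD;
    [exact: Ck_continuous hf Ux|exact: Ck_continuous hg Ux].
apply: (CkI (df := fun i x => partial i f x + partial i g x)) => // [x Ux|i x Ux|i].
- by apply: continuousD; [exact: Ck_continuous hf Ux|exact: Ck_continuous hg Ux].
- by apply: is_derive_add; [exact: Ck_is_derive hf Ux|exact: Ck_is_derive hg Ux].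
- by apply: IH; exact: Ck_partial.
Qed.

Lemma Ck_mul k U f g : open U -> Ck k U f -> Ck k U g ->
  Ck k U (fun x => f x * g x).
Proof.
move=> oU; elim: k f g => [|k IH] f g hf hg.
  by split=> // x Ux; apply: continuousM;
    [exact: Ck_continuous hf Ux|exact: Ck_continuous hg Ux].
apply: (CkI (df := fun i x => partial i f x * g x + f x * partial i g x))
  => // [x Ux|i x Ux|i].
- by apply: continuousM; [exact: Ck_continuous hf Ux|exact: Ck_continuous hg Ux].
- by apply: is_derive_mul; [exact: Ck_is_derive hf Ux|exact: Ck_is_derive hg Ux].
- by apply: Ck_add => //; apply: IH => //; (exact: Ck_partial || exact: CkW).
Qed.

Lemma Ck_scale k U (c : R) f : open U -> Ck k U f -> Ck k U (fun x => c * f x).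
Proof. by move=> oU hf; apply: Ck_mul => //; exact: Ck_cst. Qed.

Lemma Ck_opp k U f : open U -> Ck k U f -> Ck k U (fun x => - f x).
Proof.
move=> oU hf; apply: Ck_ext (Ck_scale (-1) oU hf) => // x _.
by rewrite mulN1r.
Qed.

Lemma Ck_sub k U f g : open U -> Ck k U f -> Ck k U g ->
  Ck k U (fun x => f x - g x).
Proof. by move=> oU hf hg; apply: Ck_add => //; exact: Ck_opp. Qed.

Lemma Ck_inv k U f : open U -> (forall x, U x -> f x != 0) -> Ck k U f ->
  Ck k U (fun x => (f x)^-1).
Proof.
move=> oU f0; elim: k => [|k IH] hf.
  by split=> // x Ux; apply: continuousV;
    [exact: f0|exact: Ck_continuous hf Ux].
apply: (CkI (df := fun i x => - (partial i f x * ((f x)^-1 * (f x)^-1))))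
  => // [x Ux|i x Ux|i].
- by apply: continuousV; [exact: f0|exact: Ck_continuous hf Ux].
- apply: is_derive_eq (is_derive_inv (Ck_is_derive i hf Ux) (f0 x Ux)) _.
  by rewrite expr2 invfM.
- apply: Ck_opp => //; apply: Ck_mul => //; first exact: Ck_partial.
  by apply: Ck_mul => //; apply: IH; exact: CkW.
Qed.

Lemma Ck_sum k U (I : Type) (r : seq I) (P : pred I) (F : I -> 'rV[R]_n -> R) :
  open U -> (forall i, P i -> Ck k U (F i)) ->
  Ck k U (fun x => \sum_(i <- r | P i) F i x).
Proof.
move=> oU hF; elim: r => [|a r IH].
  by apply: Ck_ext (Ck_cst k 0 oU) => // x _; rewrite big_nil.
have [Pa|Pa] := boolP (P a).
  by apply: Ck_ext (Ck_add oU (hF a Pa) IH) => // x _; rewrite big_cons Pa.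
by apply: Ck_ext IH => // x _; rewrite big_cons (negbTE Pa).
Qed.

Lemma Ck_prod k U (I : Type) (r : seq I) (P : pred I) (F : I -> 'rV[R]_n -> R) :
  open U -> (forall i, P i -> Ck k U (F i)) ->
  Ck k U (fun x => \prod_(i <- r | P i) F i x).
Proof.
move=> oU hF; elim: r => [|a r IH].
  by apply: Ck_ext (Ck_cst k 1 oU) => // x _; rewrite big_nil.
have [Pa|Pa] := boolP (P a).
  by apply: Ck_ext (Ck_mul oU (hF a Pa) IH) => // x _; rewrite big_cons Pa.
by apply: Ck_ext IH => // x _; rewrite big_cons (negbTE Pa).
Qed.

Lemma Ck_det k U m (A : 'rV[R]_n -> 'M[R]_m) : open U ->
  (forall i j, Ck k U (fun x => A x i j)) -> Ck k U (fun x => \det (A x)).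
Proof.
move=> oU hA; rewrite /determinant; apply: Ck_sum => // s _.
by apply: Ck_scale => //; apply: Ck_prod.
Qed.

(** The entries of the inverse matrix are, by the formula of Cramer, rational
    functions of the entries of the matrix. *)
Lemma Ck_invmx k U m (A : 'rV[R]_n -> 'M[R]_m) : open U ->
  (forall x, U x -> A x \in unitmx) -> (forall i j, Ck k U (fun x => A x i j)) ->
  forall i j, Ck k U (fun x => invmx (A x) i j).
Proof.
move=> oU uA hA i j.
have h : Ck k U (fun x => (\det (A x))^-1 * \adj (A x) i j).
  apply: Ck_mul => //.
    apply: Ck_inv => // [x Ux|]; last exact: Ck_det.
    by have := uA x Ux; rewrite unitmxE unitfE.
  have h : Ck k U (fun x => (-1) ^+ (j + i) * \det (row' j (col' i (A x)))).
    apply: Ck_scale => //; apply: Ck_det => // a b.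
    by apply: Ck_ext (hA (lift j a) (lift i b)) => // x _; rewrite !mxE.
  by apply: Ck_ext h => // x _; rewrite mxE.
by apply: Ck_ext h => // x Ux; rewrite /invmx uA // [RHS]mxE.
Qed.

(** The conditions in Ck are imposed point by point. *)
Lemma Ck_local k U f :
  (forall x, U x -> exists2 U', U' x & Ck k U' f) -> Ck k U f.
Proof.
elim: k f => [|k IH] f h.
  by split=> // x Ux; have [U' U'x hf] := h x Ux; exact: Ck_continuous hf U'x.
split=> [x Ux|i]; first by have [U' U'x hf] := h x Ux; exact: Ck_continuous hf U'x.
split=> [x Ux|]; first by have [U' U'x hf] := h x Ux; exact: Ck_derivable hf U'x.
by apply: IH => x Ux; have [U' U'x hf] := h x Ux; exists U' => //; exact: Ck_partial.
Qed.

Lemma Ck_subset k U U' f : U' `<=` U -> Ck k U f -> Ck k U' f.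
Proof. by move=> UU' hf; apply: Ck_local => x /UU' Ux; exists U. Qed.

Lemma Ck_succ_C1 k U f : Ck k.+1 U f -> Ck 1 U f.
Proof. by elim: k => // k IH /CkW. Qed.

Lemma is_derive_chain k (V : normedModType R) U f (c : V -> 'rV[R]_n)
    (t v : V) (dc : 'rV[R]_n) :
  open U -> Ck k.+1 U f -> U (c t) -> is_derive t v c dc ->
  is_derive t v (fun s => f (c s)) (\sum_i dc 0 i * partial i f (c t)).
Proof.
move=> oU /Ck_succ_C1 hf Uc hc; have [df dfE] := C1_differentiable oU hf Uc.
by rewrite -dfE; exact: is_derive_comp_diff.
Qed.

End CkClosure.

Section Composition.
Variables (R : realType) (m n : nat).

Lemma continuous_rV (T : topologicalType) (c : T -> 'rV[R]_n) t :
  (forall j, {for t, continuous (fun s => c s 0 j)}) -> {for t, continuous c}.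
Proof.
move=> h; apply/cvgrPdist_le => e e0; near=> s.
apply: norm_le_coord => [|j]; first exact: ltW.
rewrite !mxE; move: j; near: s; apply: filter_forall => j.
by have /cvgrPdist_le := h j; apply.
Unshelve. all: by end_near. Qed.

(** By induction on k: the partial derivatives of the composite are sums of
    products of partial derivatives of T with partial derivatives of f composed
    with T. *)
Lemma Ck_comp k (U : set 'rV[R]_m) (W : set 'rV[R]_n)
    (T : 'rV[R]_m -> 'rV[R]_n) (f : 'rV[R]_n -> R) :
  open U -> open W -> (forall x, U x -> W (T x)) ->
  (forall j, Ck k U (fun x => T x 0 j)) -> Ck k W f -> Ck k U (fun x => f (T x)).
Proof.
move=> oU oW UW; elim: k f => [|k IH] f hT hf.
  split=> // x Ux; apply: continuous_comp.
    by apply: continuous_rV => j; exact: Ck_continuous (hT j) Ux.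
  exact: Ck_continuous hf (UW _ Ux).
apply: (CkI (df := fun i x =>
    \sum_j partial i (fun x => T x 0 j) x * partial j f (T x))) => // [x Ux|i x Ux|i].
- apply: continuous_comp.
    by apply: continuous_rV => j; exact: Ck_continuous (hT j) Ux.
  exact: Ck_continuous hf (UW _ Ux).
- have hd : is_derive x (delta_mx 0 i) T (\row_j partial i (fun x => T x 0 j) x).
    by apply/is_derive_mxP => a j; rewrite !mxE ord1; exact: Ck_is_derive (hT j) Ux.
  apply: is_derive_eq (is_derive_chain oW hf (UW _ Ux) hd) _.
  by apply: eq_bigr => j _; rewrite mxE.
- apply: Ck_sum => // j _; apply: Ck_mul => //; first exact: Ck_partial.
  by apply: IH => [j'|]; [exact: CkW|exact: Ck_partial].
Qed.

End Composition.

(** * Symmetry of second derivatives and local Lipschitz bounds *)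

Section Schwarz.
Variables (R : realType) (n : nat).
Implicit Types (f g : 'rV[R]_n -> R) (U : set 'rV[R]_n) (x v w : 'rV[R]_n).
Local Notation e_ i := (delta_mx 0 i : 'rV[R]_n).

Lemma is_derive_translate f x v w df : is_derive (x + w) v f df ->
  is_derive x v (fun y => f (y + w)) df.
Proof.
move=> /is_derive_at0 h; apply/is_derive_at0.
by apply: is_derive_eqfun h _ => s; rewrite addrA.
Qed.

Lemma norm_delta i : `|e_ i| <= 1 :> R.
Proof.
apply: norm_le_coord => // j; rewrite mxE eqxx /=.
by case: (j == i); rewrite ?normr1 ?normr0.
Qed.

(** The second difference of f over the square with sides s e_i and s e_j is a
    value of a mixed second derivative, by the mean value theorem applied first
    along e_i and then along e_j. *)
Lemma second_difference f a i j (s d : R) : 0 <= s -> s + s <= d ->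
  (forall x, `|x - a| <= d -> derivable f x (e_ i) /\
     derivable (partial i f) x (e_ j)) ->
  exists2 x, `|x - a| <= d &
    f (a + s *: e_ i + s *: e_ j) - f (a + s *: e_ i) - f (a + s *: e_ j) + f a
      = s * (s * partial j (partial i f) x).
Proof.
move=> s0 sd hd.
have near_a (t u : R) : 0 <= t <= 1 -> 0 <= u <= 1 ->
    `|a + (t * s) *: e_ i + (u * s) *: e_ j - a| <= d.
  move=> /andP[t0 t1] /andP[u0 u1].
  rewrite -[a + _ + _]addrA addrAC subrr add0r (le_trans (ler_normD _ _)) //.
  apply: le_trans sd; apply: lerD; rewrite normrZ ger0_norm ?mulr_ge0 //.
    by rewrite -[leRHS]mul1r -mulrA ler_pM // ?mulr_ge0 // ler_piMr // norm_delta.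
  by rewrite -[leRHS]mul1r -mulrA ler_pM // ?mulr_ge0 // ler_piMr // norm_delta.
have I0 : 0 <= (0 : R) <= 1 by rewrite lexx ler01.
have I1 : 0 <= (1 : R) <= 1 by rewrite lexx ler01.
pose phi x := f (x + s *: e_ j) - f x.
have dphi (t : R) : 0 <= t <= 1 -> is_derive (a + (t * s) *: e_ i) (e_ i) phi
    (partial i f (a + (t * s) *: e_ i + s *: e_ j) - partial i f (a + (t * s) *: e_ i)).
  move=> t01; apply: is_derive_sub.
    apply: is_derive_translate; apply: DeriveDef => //.
    by have [] := hd _ (near_a t 1 t01 I1); rewrite mul1r.
  apply: DeriveDef => //.
  by have [] := hd _ (near_a t 0 t01 I0); rewrite mul0r scale0r addr0.
have [|t t01] := @mvt_line R _ phi a (e_ i) s; first by move=> t /dphi [].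
have [_ ->] := dphi t t01.
have [|u u01] := @mvt_line R _ (partial i f) (a + (t * s) *: e_ i) (e_ j) s.
  by move=> u u01; have [] := hd _ (near_a t u t01 u01).
move=> -> phiE; exists (a + (t * s) *: e_ i + (u * s) *: e_ j); first exact: near_a.
rewrite -[RHS]phiE /phi opprB addrA addrAC; congr (_ + _); exact: addrAC.
Qed.

(** The two mixed derivatives take equal values at two points as close to a as
    desired, because the second difference over a square is symmetric in the two
    directions; by continuity they agree at a. *)
Lemma partialC U f a i j : open U -> Ck 2 U f -> U a ->
  partial i (partial j f) a = partial j (partial i f) a.
Proof.
move=> oU hf Ua; apply/eqP; rewrite -subr_eq0 -normr_le0.
apply/ler_addgt0Pl => e e0; rewrite addr0.
have e2 : 0 < e / 2 by rewrite divr_gt0.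
have hc k l : \forall x \near a,
    `|partial k (partial l f) x - partial k (partial l f) a| <= e / 2.
  apply: continuous_near_le e2; exact: Ck_continuous (Ck_partial k (Ck_partial l hf)) Ua.
have /nbhs_ball_le[d d0 hd] : nbhs a [set x | U x /\
    (`|partial i (partial j f) x - partial i (partial j f) a| <= e / 2 /\
     `|partial j (partial i f) x - partial j (partial i f) a| <= e / 2)].
  apply: filterI; first exact: open_nbhs_nbhs.
  exact: filterI (hc i j) (hc j i).
pose s := d / 2.
have s0 : 0 < s by rewrite divr_gt0.
have ss : s + s <= d by rewrite -splitr.
have hij k l x : `|x - a| <= d -> derivable f x (e_ k) /\
    derivable (partial k f) x (e_ l).
  move=> /hd[Ux _]; split; first exact: Ck_derivable hf Ux.
  exact: Ck_derivable (Ck_partial k hf) Ux.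
have [x /hd[_ [_ hx]] Ex] := second_difference (ltW s0) ss (hij i j).
have [y /hd[_ [hy _]] Ey] := second_difference (ltW s0) ss (hij j i).
have xy : partial j (partial i f) x = partial i (partial j f) y.
  (* Multiplied by s ^ 2, both sides are the same second difference. *)
  apply: (mulfI (lt0r_neq0 s0)); apply: (mulfI (lt0r_neq0 s0)).
  apply: etrans (esym Ex) _; apply: etrans _ Ey; congr (_ + _).
  have -> : a + s *: e_ j + s *: e_ i = a + s *: e_ i + s *: e_ j by exact: addrAC.
  exact: addrAC.
rewrite xy in hx.
move: hx hy {Ex Ey xy hc hd hij}.
move: (partial i (partial j f) y) (partial i (partial j f) a).
move: (partial j (partial i f) a) => B p A hB hA.
by rewrite -(subrKA p) [e]splitr (le_trans (ler_normD _ _)) // lerD // distrC.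
Qed.

(** Near a the partial derivatives of each component are bounded by their absolute
    value at a plus one; the mean value theorem applies along segments, which stay
    in the convex ball. *)
Lemma C1_locally_lipschitz p U (f : 'rV[R]_n -> 'rV[R]_p) a : open U ->
  (forall j, Ck 1 U (fun x => f x 0 j)) -> U a ->
  exists2 d : R, 0 < d & exists2 K : R, 0 <= K &
    forall x y, `|x - a| <= d -> `|y - a| <= d -> `|f x - f y| <= K * `|x - y|.
Proof.
move=> oU hf Ua.
have /nbhs_ball_le[d d0 hd] := nbhs_forall (fun j => C1_partials_near oU (hf j) Ua ltr01).
pose k j := \sum_i (`|partial i (fun x => f x 0 j) a| + 1).
have k0 j : 0 <= k j by apply: sumr_ge0 => i _; rewrite addr_ge0.
exists d => //; exists (\sum_j k j); first by apply: sumr_ge0.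
move=> x y hx hy.
have hseg (t : R) : 0 <= t <= 1 -> `|y + (t * 1) *: (x - y) - a| <= d.
  move=> /andP[t0 t1]; rewrite mulr1.
  have -> : y + t *: (x - y) - a = t *: (x - a) + (1 - t) *: (y - a).
    by apply/rowP => k'; rewrite !mxE; ring.
  have t2 : 0 <= 1 - t by rewrite subr_ge0.
  rewrite (le_trans (ler_normD _ _)) // !normrZ ger0_norm // (ger0_norm t2).
  have -> : d = t * d + (1 - t) * d by ring.
  by apply: lerD; apply: ler_wpM2l.
apply: norm_le_coord => [|j].
  by rewrite mulr_ge0 //; apply: sumr_ge0.
rewrite !mxE; apply: (@le_trans _ _ (k j * `|x - y|)); last first.
  by rewrite ler_wpM2r // (bigD1 j) //= lerDl; apply: sumr_ge0.
pose g := fun x => f x 0 j.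
have hder (t : R) : 0 <= t <= 1 -> is_derive (y + (t * 1) *: (x - y)) (x - y) g
   (\sum_i (x - y) 0 i * partial i g (y + (t * 1) *: (x - y))).
  move=> /hseg /hd /(_ j)[Uz _].
  exact: (is_derive_chain (c := id) oU (hf j) Uz (is_derive_id _ _)).
have [t t01|t t01] := @mvt_line R _ g y (x - y) 1; first by have [] := hder t t01.
have [_ ->] := hder t t01.
have -> : y + 1 *: (x - y) = x by rewrite scale1r addrC subrK.
rewrite mul1r => ->.
rewrite (le_trans (ler_norm_sum _ _ _)) // mulr_suml; apply: ler_sum => i _.
rewrite normrM mulrC; apply: ler_pM => //; last exact: coord_le_norm.
have [_ h] := hd _ (hseg t t01) j.
by rewrite -lerBlDl (le_trans _ (h i)) // lerB_dist.
Qed.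

End Schwarz.

(** * Ordinary differential equations: the theorem of Picard *)

Section Antiderivative.
Variables (R : realType).

Definition clamp (a t : R) : R := Num.max (- a) (Num.min a t).

Lemma clamp_id a t : `|t| <= a -> clamp a t = t.
Proof.
by rewrite ler_norml => /andP[h1 h2]; rewrite /clamp min_r // max_r.
Qed.

Lemma norm_clamp a t : 0 <= a -> `|clamp a t| <= a.
Proof.
move=> a0; rewrite /clamp ler_norml le_max lexx /= ge_max ge_min lexx /=.
by rewrite andbT; apply: le_trans (_ : 0 <= _); rewrite ?oppr_le0.
Qed.

(** Clamping to an interval does not increase distances; this extends a Lipschitz
    function on a box to the whole space. *)
Lemma clamp_dist a s t : `|clamp a s - clamp a t| <= `|s - t|.
Proof.
wlog st : s t / s <= t.
  by move=> h; have [/h//|/ltW /h] := leP s t; rewrite distrC [`|t - s|]distrC.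
have maxM (x y z : R) : y <= z -> Num.max x y <= Num.max x z.
  by move=> yz; rewrite ge_max !le_max lexx yz orbT.
have minM (x y z : R) : y <= z -> Num.min x y <= Num.min x z.
  by move=> yz; rewrite le_min !ge_min lexx yz orbT.
have m : clamp a s <= clamp a t by apply: maxM; exact: minM.
rewrite distrC [leRHS]distrC !ger0_norm ?subr_ge0 //.
rewrite /clamp; case: (leP a s) => h1; case: (leP a t) => h2;
  by [case: (leP (- a) a) => h3; lra|case: (leP (- a) a) => h3; lra
     |case: (leP (- a) s) => h3; case: (leP (- a) a) => h4; lra
     |case: (leP (- a) s) => h3; case: (leP (- a) t) => h4; lra].
Qed.

Lemma continuous_clamp a : continuous (clamp a).
Proof.
move=> t; apply/cvgrPdist_le => e e0; near=> s.
apply: le_trans (clamp_dist _ _ _) _.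
by near: s; exact: cvgr_dist_le.
Unshelve. all: by end_near. Qed.

Lemma near_norm_lt (a t : R) : `|t| < a -> \forall s \near t, `|s| < a.
Proof.
move=> ta; have /cvgrPdist_lt h := @norm_continuous R R^o t.
have := h _ (_ : 0 < a - `|t|); rewrite subr_gt0 => /(_ ta); apply: filterS => s.
by rewrite ltr_norml => /andP[h1 h2]; lra.
Qed.

(** The antiderivative is frozen outside of the interval [-a, a]: it is then
    continuous everywhere, and the integrand need not be restricted. *)
Lemma antiderivative (a : R) (h : R -> R) : 0 < a -> continuous h ->
  exists F : R -> R, [/\ F 0 = 0, continuous F, forall t, F (clamp a t) = F t &
    forall t : R, `|t| < a -> is_derive t 1 F (h t)].
Proof.
(* Integrating from - b instead of - a makes the integral
   differentiable at the end points of [-a, a] too. *)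
move=> a0 ch; pose b := a + 1.
have ab : a < b by rewrite ltrDl.
have ih : (@lebesgue_measure R).-integrable `[- b, b] (EFin \o h).
  apply: continuous_compact_integrable; first exact: segment_compact.
  by apply: continuous_subspaceT.
have [G hG] : exists G : R -> R, forall t : R, `|t| < b ->
    derivable G t 1 /\ G^`()%classic t = h t.
  exists (fun x => \int[@lebesgue_measure R]_(s in `[- b, x]) h s) => t.
  rewrite ltr_norml => /andP[h1 h2].
  exact: (@continuous_FTC1_closed R h (- b) t b h2 ih h1 (ch t)).
have dG (t : R) : `|t| < b -> is_derive t 1 G (h t).
  by move=> /hG[d e]; apply: DeriveDef => //; rewrite -derive1E.
have cl0 : clamp a 0 = 0 by rewrite clamp_id // normr0 ltW.
have cG t : {for clamp a t, continuous G}.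
  have [|h1 _] := dG (clamp a t); first by rewrite (le_lt_trans (norm_clamp _ (ltW a0))).
  by apply/differentiable_continuous/derivable1_diffP.
exists (fun t => G (clamp a t) - G 0); split.
- by rewrite cl0 subrr.
- move=> t; apply: continuousB; last exact: cst_continuous.
  by apply: continuous_comp; [exact: continuous_clamp|exact: cG].
- by move=> t; rewrite (@clamp_id _ (clamp a t)) // norm_clamp // ltW.
- move=> t ta; rewrite -[h t]subr0.
  apply: is_derive_sub.
  apply: near_eq_is_derive (dG t (lt_trans ta ab)).
  by apply: filterS (near_norm_lt ta) => s /ltW sa; rewrite clamp_id.
Qed.

(** Bounds antiderivatives by the mean value theorem, without estimating integrals. *)
Lemma norm_le_deriv (a B : R) (F h : R -> R) : 0 < a -> F 0 = 0 -> continuous F ->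
  (forall t : R, `|t| < a -> is_derive t 1 F (h t)) ->
  (forall t : R, `|t| < a -> `|h t| <= B) ->
  forall t, `|t| <= a -> `|F t| <= a * B.
Proof.
move=> a0 F0 cF dF hB t ta.
have B0 : 0 <= B by apply: le_trans (normr_ge0 _) (hB 0 _); rewrite normr0.
have key (u v : R) : `|u| <= a -> `|v| <= a -> u <= v ->
    exists2 c, `|F v - F u| = `|h c| * `|v - u| & (`|c| < a \/ u = v).
  move=> ua va; rewrite le_eqVlt => /orP[/eqP->|uv].
    by exists 0; [rewrite !subrr normr0 mulr0|right].
  have inI x : x \in `]u, v[ -> `|x| < a.
    rewrite in_itv /= ltr_norml => /andP[h1 h2].
    move: ua va; rewrite !ler_norml => /andP[h3 _] /andP[_ h4].
    by rewrite (le_lt_trans h3) //= (lt_le_trans h2).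
  have [||c cI ->] := @MVT R F h u v uv.
  - by move=> x /inI /dF.
  - by apply: continuous_subspaceT.
  - by exists c; [rewrite normrM|left; exact: inI].
have fin c : (`|c| < a \/ t = 0) -> `|h c| * `|t| <= a * B.
  case=> [ca|->]; last by rewrite normr0 mulr0 mulr_ge0 // ltW.
  by rewrite mulrC ler_pM // hB.
have z0 : `|0 : R| <= a by rewrite normr0 ltW.
have [t0|/ltW t0] := leP 0 t.
  have [c] := key 0 t z0 ta t0; rewrite F0 !subr0 => -> hc; apply: fin.
  by case: hc; [left|right].
have [c] := key t 0 ta z0 t0; rewrite F0 !sub0r !normrN => -> hc; exact: fin.
Qed.

(** The sequences u_m - 2 C / 2^m and u_m + 2 C / 2^m are monotone and enclose the
    limit, which is therefore the supremum of the first one; the error bound is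
    explicit. *)
Lemma geometric_limit (u : nat -> R) (C : R) : 0 <= C ->
  (forall m, `|u m.+1 - u m| <= C / 2 ^+ m) ->
  exists l, forall m, `|l - u m| <= 2 * C / 2 ^+ m.
Proof.
move=> C0 hu.
pose v m := u m - 2 * C / 2 ^+ m; pose w m := u m + 2 * C / 2 ^+ m.
have half m : 2 * C / 2 ^+ m.+1 = C / 2 ^+ m :> R.
  by rewrite exprS invfM mulrACA divff ?mul1r // pnatr_eq0.
have dbl m : 2 * C / 2 ^+ m = C / 2 ^+ m + C / 2 ^+ m :> R.
  by rewrite -mulrA mulr_natl mulr2n.
have vS m : v m <= v m.+1.
  by rewrite /v half dbl; have := hu m; rewrite ler_norml => /andP[h _]; lra.
have wS m : w m.+1 <= w m.
  by rewrite /w half dbl; have := hu m; rewrite ler_norml => /andP[_ h]; lra.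
have vw m : v m <= w m.
  by rewrite /v /w lerD2l; apply: le_trans (_ : 0 <= _); rewrite ?oppr_le0 divr_ge0 ?mulr_ge0 ?exprn_ge0.
have vM := homo_leq (@lexx _ R) (@le_trans _ R) vS.
have wM := homo_leq (r := fun x y : R => y <= x) (@lexx _ R)
  (fun y x z h1 h2 => le_trans h2 h1) wS.
have vwM k m : v k <= w m.
  have [km|/ltnW mk] := leqP k m; first exact: le_trans (vM _ _ km) (vw m).
  exact: le_trans (vw k) (wM _ _ mk).
have ub m : ubound (range v) (w m) by move=> _ [k _ <-]; exact: vwM.
have v0 : range v !=set0 by exists (v 0%N); exists 0%N.
exists (sup (range v)) => m.
have h1 : sup (range v) <= w m by exact: ge_sup.
have h2 : v m <= sup (range v).
  by apply: ub_le_sup; [exists (w 0%N); exact: ub|exists m].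
by move: h1 h2; rewrite /v /w ler_norml => h1 h2; apply/andP; split; lra.
Qed.

End Antiderivative.

Lemma continuous_of_dist (R : realType) (V W : normedModType R) (f : V -> W) x :
  (forall e : R, 0 < e -> exists2 d : R, 0 < d &
     forall y, `|x - y| <= d -> `|f x - f y| <= e) -> {for x, continuous f}.
Proof.
move=> h; apply/cvgrPdist_le => e e0; have [d d0 hd] := h e e0.
by near=> y; apply: hd; near: y; apply: cvgr_dist_le.
Unshelve. all: by end_near. Qed.

Lemma continuous_coord_comp (R : realType) (N : nat) (T : topologicalType)
    (F : T -> 'rV[R]_N) j t :
  {for t, continuous F} -> {for t, continuous (fun s => F s 0 j)}.
Proof.
move=> c; apply: (@continuous_comp _ _ _ F (fun v : 'rV[R]_N => v 0 j) t c).
exact: coord_continuous.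
Qed.

Section Picard.
Variables (R : realType) (N : nat).
Implicit Types (h F : R -> 'rV[R]_N).

Lemma antiderivative_rV (a : R) h : 0 < a -> continuous h ->
  exists F, [/\ F 0 = 0, continuous F, forall t, F (clamp a t) = F t &
    forall t : R, `|t| < a -> is_derive t 1 F (h t)].
Proof.
move=> a0 ch.
have chj j : continuous (fun t => h t 0 j).
  by move=> t; apply: continuous_coord_comp; exact: ch.
have [f hf] := choice (fun j => antiderivative a0 (chj j)).
exists (fun t => \row_j f j t); split.
- by apply/rowP => j; rewrite !mxE; have [-> _ _ _] := hf j.
- move=> t; apply: continuous_rV => j.
  have [_ c _ _] := hf j.
  by apply: continuous_eqfun (c t) => s; rewrite mxE.
- by move=> t; apply/rowP => j; rewrite !mxE; have [_ _ -> _] := hf j.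
- move=> t ta; apply/is_derive_mxP => i j; rewrite ord1.
  have [_ _ _ d] := hf j.
  by apply: is_derive_eqfun (d t ta) _ => s; rewrite mxE.
Qed.

Lemma norm_le_deriv_rV (a B : R) F h : 0 < a -> F 0 = 0 -> continuous F ->
  (forall t, F (clamp a t) = F t) ->
  (forall t : R, `|t| < a -> is_derive t 1 F (h t)) ->
  (forall t : R, `|t| < a -> `|h t| <= B) -> forall t, `|F t| <= a * B.
Proof.
move=> a0 F0 cF cl dF hB t; rewrite -cl.
have B0 : 0 <= B by apply: le_trans (normr_ge0 _) (hB 0 _); rewrite normr0.
apply: norm_le_coord => [|j]; first by rewrite mulr_ge0 // ltW.
apply: (@norm_le_deriv R a B (fun s => F s 0 j) (fun s => h s 0 j)) => //.
- by rewrite F0 mxE.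
- by move=> s; apply: continuous_coord_comp; exact: cF.
- by move=> s sa; have /is_derive_mxP := dF s sa.
- by move=> s sa; apply: le_trans (coord_le_norm _ _) (hB s sa).
- by rewrite norm_clamp // ltW.
Qed.

Lemma continuous_lipschitz (f : 'rV[R]_N -> 'rV[R]_N) (K : R) :
  (forall x y, `|f x - f y| <= K * `|x - y|) -> continuous f.
Proof.
move=> hK x; apply: continuous_of_dist => e e0.
have K1 : 0 < `|K| + 1 by rewrite ltr_wpDl.
exists (e / (`|K| + 1)) => [|y]; first by rewrite divr_gt0.
rewrite ler_pdivlMr // mulrC => h; apply: le_trans h; apply: le_trans (hK _ _) _.
by rewrite ler_wpM2r // (le_trans (ler_norm _)) // lerDl.
Qed.

(** Picard iteration on an interval so short that the integral operator halves
    distances; the iterates are frozen outside of the interval, which makes all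
    of them continuous on the whole line. *)
Lemma ode_global_lipschitz (f : 'rV[R]_N -> 'rV[R]_N) (K : R) z : 0 <= K ->
  (forall x y, `|f x - f y| <= K * `|x - y|) ->
  exists2 a : R, 0 < a & exists y : R -> 'rV[R]_N,
    [/\ y 0 = z, continuous y &
      forall t : R, `|t| < a -> is_derive t 1 y (f (y t))].
Proof.
move=> K0 hK; have cf := continuous_lipschitz hK.
(* With this length, a * K <= 1 / 2. *)
pose a := (2 * (K + 1))^-1; have K1 : 0 < K + 1 by rewrite ltr_wpDl.
have a0 : 0 < a by rewrite invr_gt0 mulr_gt0.
have aK D : 0 <= D -> a * (K * D) <= D / 2.
  move=> D0; rewrite mulrA [leRHS]mulrC ler_wpM2r // /a invfM -mulrA.
  by rewrite ler_piMr // mulrC ler_pdivrMr // mul1r lerDl.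
have cfc h : continuous h -> continuous (fun t => f (h t)).
  by move=> ch t; apply: continuous_comp; [exact: ch|exact: cf].
(* Phi h is the integral of f o h; for discontinuous h it is arbitrary. *)
have exPhi h : exists F, continuous h -> [/\ F 0 = 0, continuous F,
    forall t, F (clamp a t) = F t &
    forall t : R, `|t| < a -> is_derive t 1 F (f (h t))].
  have [ch|nch] := pselect (continuous h); last by exists h => /nch.
  by have [F hF] := antiderivative_rV a0 (cfc h ch); exists F.
have [Phi hPhi] := choice exPhi.
have Phi_dist h1 h2 (B : R) : continuous h1 -> continuous h2 ->
    (forall t, `|h1 t - h2 t| <= B) -> forall t, `|Phi h1 t - Phi h2 t| <= B / 2.
  move=> c1 c2 hB t.
  have B0 : 0 <= B by exact: le_trans (normr_ge0 _) (hB 0).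
  have [p0 pc pcl pd] := hPhi _ c1; have [q0 qc qcl qd] := hPhi _ c2.
  apply: le_trans (aK _ B0).
  apply: (@norm_le_deriv_rV a (K * B) (fun s => Phi h1 s - Phi h2 s)
    (fun s => f (h1 s) - f (h2 s))) => //.
  - by rewrite p0 q0 subrr.
  - by move=> s; apply: continuousB; [exact: pc|exact: qc].
  - by move=> s; rewrite pcl qcl.
  - by move=> s sa; apply: is_deriveB; [exact: pd|exact: qd].
  - by move=> s _; rewrite (le_trans (hK _ _)) // ler_wpM2l.
pose y := fix y m := if m is m'.+1 then fun t => z + Phi (y m') t else fun=> z.
have cy m : continuous (y m).
  elim: m => [|m IH] t /=; first exact: cst_continuous.
  by apply: continuousD; [exact: cst_continuous|have [_ c _ _] := hPhi _ IH; exact: c].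
pose C := a * `|f z|; have C0 : 0 <= C by rewrite mulr_ge0 // ltW.
have hy m t : `|y m.+1 t - y m t| <= C / 2 ^+ m.
  elim: m t => [|m IH] t.
    rewrite /= addrC addKr expr0 divr1.
    have [p0 pc pcl pd] := hPhi _ (cy 0%N).
    by apply: (norm_le_deriv_rV a0 p0 pc pcl pd).
  have -> : y m.+2 t - y m.+1 t = Phi (y m.+1) t - Phi (y m) t.
    by rewrite /= opprD addrACA subrr add0r.
  by rewrite exprS invfM [2^-1 * _]mulrC mulrA; apply: Phi_dist => //; exact: cy.
have exl t j : exists l, forall m, `|l - y m t 0 j| <= 2 * C / 2 ^+ m.
  apply: geometric_limit C0 _ => m; apply: le_trans (hy m t).
  by apply: le_trans (coord_le_norm _ j); rewrite !mxE.
have [l hl] := choice (fun p => exl p.1 p.2).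
pose x t := \row_j l (t, j).
have bnd0 m : 0 <= 2 * C / 2 ^+ m.
  by apply: divr_ge0; [apply: mulr_ge0|apply: exprn_ge0].
have hx m t : `|x t - y m t| <= 2 * C / 2 ^+ m.
  by apply: norm_le_coord => // j; rewrite !mxE; exact: (hl (t, j)).
have small e : 0 < e -> exists m, 2 * C / 2 ^+ m <= e.
  move=> e0; have [m hm] : exists m, 2 * C / e <= 2 ^+ m.
    have [k hk] : exists k, 2 * C / e < k%:R by have := archi_boundP (_ : 0 <= 2 * C / e); exists (Num.Def.archi_bound (2 * C / e)); apply: archi_boundP; rewrite divr_ge0 ?mulr_ge0 // ltW.
    exists k; rewrite (le_trans (ltW hk)) // -natrX ler_nat ltnW //.
    exact: ltn_expl.
  by exists m; rewrite ler_pdivrMr ?exprn_gt0 // [e * _]mulrC -ler_pdivrMr.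
have cx : continuous x.
  move=> t; apply/cvgrPdist_le => e e0.
  have [m hm] : exists m, 2 * C / 2 ^+ m <= e / 3 by apply: small; rewrite divr_gt0.
  have e3 : 0 < e / 3 by rewrite divr_gt0.
  near=> s.
  have h1 := le_trans (hx m t) hm; have h2 := le_trans (hx m s) hm.
  have h3 : `|y m t - y m s| <= e / 3 by near: s; apply: cvgr_dist_le => //; exact: cy.
  have -> : x t - x s = (x t - y m t) + (y m t - y m s) - (x s - y m s).
    by apply/rowP => j; rewrite !mxE; ring.
  rewrite (le_trans (ler_normB _ _)) // (le_trans (lerD (ler_normD _ _) (lexx _))) //.
  by lra.
have xE t : x t = z + Phi x t.
  apply/eqP; rewrite -subr_eq0 -normr_le0; apply/ler_addgt0Pl => e e0; rewrite addr0.
  have [m hm] := small _ e0.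
  have -> : x t - (z + Phi x t) = (x t - y m.+1 t) - (Phi x t - Phi (y m) t).
    by rewrite /=; apply/rowP => j; rewrite !mxE; ring.
  rewrite (le_trans (ler_normB _ _)) // (le_trans _ hm) //.
  have h1 := hx m.+1 t.
  have h2 := @Phi_dist x (y m) _ cx (cy m) (hx m) t.
  move: h1 h2; rewrite exprS invfM mulrACA divff ?pnatr_eq0 // mul1r.
  by rewrite -!mulrA !(mulrA 2) => h1 h2; lra.
exists a => //; exists x; have [p0 _ _ pd] := hPhi _ cx.
split=> //; first by rewrite xE p0 addr0.
move=> t ta; have := pd t ta => d.
rewrite [X in is_derive _ _ X](_ : x = fun t => z + Phi x t); last exact/funext.
rewrite -[f (x t)]add0r; apply: is_deriveD.
Unshelve. all: by end_near. Qed.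

(** The right-hand side is composed with the retraction onto a box around z on
    which it is Lipschitz.  The solution of the modified equation starts at the
    centre of the box, hence solves the original equation for a short time. *)
Lemma ode_local (U : set 'rV[R]_N) (f : 'rV[R]_N -> 'rV[R]_N) z :
  open U -> (forall j, Ck 1 U (fun x => f x 0 j)) -> U z ->
  exists2 a : R, 0 < a & exists2 y : R -> 'rV[R]_N, y 0 = z &
    forall t : R, `|t| < a -> U (y t) /\ is_derive t 1 y (f (y t)).
Proof.
move=> oU hf Uz.
have [d1 d10 [K K0 hK]] := C1_locally_lipschitz oU hf Uz.
have /nbhs_ball_le[d2 d20 hU] := open_nbhs_nbhs (conj oU Uz).
pose d := Num.min d1 d2; have d0 : 0 < d by rewrite lt_min d10.
pose box (x : 'rV[R]_N) : 'rV[R]_N := \row_j (z 0 j + clamp d (x 0 j - z 0 j)).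
have box_in x : `|box x - z| <= d.
  apply: norm_le_coord => [|j]; first exact: ltW.
  by rewrite !mxE addrC addKr norm_clamp // ltW.
have box_id x : `|x - z| <= d -> box x = x.
  move=> xd; apply/rowP => j; rewrite mxE clamp_id ?subrKC //; last first.
    by apply: le_trans xd; apply: le_trans (coord_le_norm _ j); rewrite !mxE.
have box_lip x y : `|box x - box y| <= `|x - y|.
  apply: norm_le_coord => // j; rewrite !mxE opprD addrACA subrr add0r.
  apply: le_trans (clamp_dist _ _ _) _; rewrite opprB addrA subrK.
  by apply: le_trans (coord_le_norm _ j); rewrite !mxE.
have [|a a0 [y [y0 cy dy]]] := @ode_global_lipschitz (f \o box) K z K0.
  move=> x y /=; apply: le_trans (hK _ _ _ _) _.
  - by apply: le_trans (box_in _) _; rewrite ge_min lexx.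
  - by apply: le_trans (box_in _) _; rewrite ge_min lexx.
  - by rewrite ler_wpM2l.
have /nbhs_ballP[b /= b0 hb] : \forall t \near 0, `|y t - z| <= d.
  have /cvgrPdist_le := cy 0; rewrite y0 => /(_ _ d0).
  by apply: filterS => t; rewrite distrC.
exists (Num.min a b); first by rewrite lt_min a0.
exists y => // t; rewrite lt_min => /andP[ta tb].
have yd : `|y t - z| <= d by apply: hb; rewrite -ball_normE /= sub0r normrN.
split; first by apply: hU; apply: le_trans yd _; rewrite ge_min lexx orbT.
by have := dy t ta; rewrite /= box_id.
Qed.

End Picard.

(** * Covariance of the geodesic equation *)

Section MatrixPartials.
Variables (R : realType) (n : nat).
Implicit Types (a : 'rV[R]_n).

Definition partial_mx p q i (A : 'rV[R]_n -> 'M[R]_(p, q)) a : 'M[R]_(p, q) :=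
  \matrix_(k, l) partial i (fun y => A y k l) a.

Definition Ck_mx k p q (U : set 'rV[R]_n) (A : 'rV[R]_n -> 'M[R]_(p, q)) :=
  forall i j, Ck k U (fun x => A x i j).

(** The derivative of A in direction u, expressed by partial derivatives so that it
    is linear in u by definition. *)
Definition direction_mx p q (A : 'rV[R]_n -> 'M[R]_(p, q)) a (u : 'cV[R]_n) :
  'M[R]_(p, q) := \sum_i u i 0 *: partial_mx i A a.

Lemma direction_mxE p q (A : 'rV[R]_n -> 'M[R]_(p, q)) a u k l :
  direction_mx A a u k l = \sum_i u i 0 * partial i (fun y => A y k l) a.
Proof. by rewrite summxE; apply: eq_bigr => i _; rewrite !mxE. Qed.

Lemma direction_mx_delta p q (A : 'rV[R]_n -> 'M[R]_(p, q)) a i :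
  direction_mx A a (delta_mx i 0) = partial_mx i A a.
Proof.
rewrite /direction_mx (bigD1 i) //= mxE !eqxx scale1r big1 ?addr0 // => j ji.
by rewrite mxE (negbTE ji) scale0r.
Qed.

Lemma is_derive_mx_chain k p q (V : normedModType R) (U : set 'rV[R]_n)
    (A : 'rV[R]_n -> 'M[R]_(p, q)) (c : V -> 'rV[R]_n) (t v : V) (dc : 'rV[R]_n) :
  open U -> Ck_mx k.+1 U A -> U (c t) -> is_derive t v c dc ->
  is_derive t v (fun s => A (c s)) (direction_mx A (c t) dc^T).
Proof.
move=> oU hA Uc hc; apply/is_derive_mxP => i j; rewrite direction_mxE.
apply: is_derive_eq (is_derive_chain oU (hA i j) Uc hc) _.
by apply: eq_bigr => l _; rewrite mxE.
Qed.

Lemma is_derive_mx_direction k p q (U : set 'rV[R]_n)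
    (A : 'rV[R]_n -> 'M[R]_(p, q)) a (v : 'rV[R]_n) : open U -> Ck_mx k.+1 U A ->
  U a -> is_derive a v A (direction_mx A a v^T).
Proof. by move=> oU hA Ua; exact: (is_derive_mx_chain (c := id) oU hA Ua). Qed.

Lemma partial_mx_sym (U : set 'rV[R]_n) (G : 'rV[R]_n -> 'M[R]_n) a i :
  open U -> (forall x, U x -> (G x)^T = G x) -> U a ->
  (partial_mx i G a)^T = partial_mx i G a.
Proof.
move=> oU hG Ua; apply/matrixP => k l; rewrite !mxE; apply: near_eq_derive.
by apply: (open_near oU Ua) => y Uy; rewrite -[in RHS](hG y Uy) mxE.
Qed.

End MatrixPartials.

Section EulerLagrange.
Variables (R : realType) (n : nat).
Implicit Types (G : 'rV[R]_n -> 'M[R]_n) (a : 'rV[R]_n) (u w : 'cV[R]_n).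

(** The l-th entry is d/dt (dE/du_l) - dE/dx_l for the energy E = (u^T G u) / 2,
    along a curve through a with velocity u and acceleration w. *)
Definition euler_lagrange G a u w : 'cV[R]_n :=
  G a *m w + direction_mx G a u *m u
  - 2^-1 *: \col_l ((u^T *m partial_mx l G a *m u) 0 0).

(** Multiplying the geodesic equation by the metric removes the inverse metric from
    the Christoffel symbols; of the three terms in these symbols the first two
    give the same contribution when contracted with u twice. *)
Lemma christoffel_euler_lagrange G a u w : G a \in unitmx ->
  (forall i, (partial_mx i G a)^T = partial_mx i G a) ->
  (forall k, w k 0 + \sum_i \sum_j christoffel G k i j a * u i 0 * u j 0 = 0) <->
  euler_lagrange G a u w = 0.
Proof.
move=> uG symG.
have sG i k l : partial i (fun y => G y k l) a = partial i (fun y => G y l k) a.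
  by have /matrixP /(_ k l) := symG i; rewrite !mxE.
pose r := direction_mx G a u *m u - 2^-1 *: \col_l ((u^T *m partial_mx l G a *m u) 0 0).
have ELE : euler_lagrange G a u w = G a *m w + r by rewrite /euler_lagrange addrA.
have key : \col_k (\sum_i \sum_j christoffel G k i j a * u i 0 * u j 0) =
    invmx (G a) *m r.
  apply/colP => k; rewrite !mxE.
  have rE l : r l 0 = 2^-1 * \sum_i \sum_j (partial i (fun y => G y j l) a +
      partial j (fun y => G y i l) a - partial l (fun y => G y i j) a) * u i 0 * u j 0.
    have E1 : (direction_mx G a u *m u) l 0 =
        \sum_i \sum_j partial i (fun y => G y j l) a * u i 0 * u j 0.
      rewrite mxE exchange_big; apply: eq_bigr => j _.
      rewrite direction_mxE mulr_suml; apply: eq_bigr => i _.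
      by rewrite sG; ring.
    have E2 : (direction_mx G a u *m u) l 0 =
        \sum_i \sum_j partial j (fun y => G y i l) a * u i 0 * u j 0.
      rewrite E1 exchange_big; apply: eq_bigr => j _; apply: eq_bigr => i _.
      by ring.
    have E3 : (u^T *m partial_mx l G a *m u) 0 0 =
        \sum_i \sum_j partial l (fun y => G y i j) a * u i 0 * u j 0.
      rewrite mxE exchange_big; apply: eq_bigr => j _.
      rewrite mxE mulr_suml; apply: eq_bigr => i _.
      by rewrite !mxE; ring.
    have -> : r l 0 = 2^-1 * ((direction_mx G a u *m u) l 0 +
        (direction_mx G a u *m u) l 0 - (u^T *m partial_mx l G a *m u) 0 0).
      rewrite /r [LHS]mxE [X in _ + X]mxE [X in _ - X]mxE [X in _ - _ * X]mxE.
      by field.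
    rewrite {1}E1 E2 E3 -big_split -sumrB; congr (_ * _).
    apply: eq_bigr => i _; rewrite -big_split -sumrB; apply: eq_bigr => j _ /=.
    by ring.
  transitivity (\sum_i \sum_j \sum_l invmx (G a) k l * (2^-1 *
     ((partial i (fun y => G y j l) a +
      partial j (fun y => G y i l) a - partial l (fun y => G y i j) a) * u i 0 * u j 0))).
    apply: eq_bigr => i _; apply: eq_bigr => j _.
    rewrite /christoffel mulr_sumr !mulr_suml.
    by apply: eq_bigr => l _; ring.
  under eq_bigr do rewrite exchange_big.
  rewrite exchange_big; apply: eq_bigr => l _; rewrite rE.
  rewrite !mulr_sumr; apply: eq_bigr => i _.
  by rewrite !mulr_sumr; apply: eq_bigr => j _.
rewrite ELE; split=> [h|h k].
  have -> : w = - (invmx (G a) *m r).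
    apply/colP => k; rewrite -key; apply/eqP; rewrite -subr_eq0; apply/eqP.
    by rewrite -[RHS](h k) !mxE opprK.
  by rewrite mulmxN mulKVmx // addNr.
have : w + invmx (G a) *m r = 0.
  by rewrite -[w](mulKmx uG) -mulmxDr h mulmx0.
by rewrite -key => /colP /(_ k); rewrite !mxE.
Qed.

End EulerLagrange.

Section Transformation.
Variables (R : realType) (n : nat).
Variables (U W : set 'rV[R]_n) (T : 'rV[R]_n -> 'rV[R]_n).
Variables (G H : 'rV[R]_n -> 'M[R]_n).
Hypotheses (oU : open U) (oW : open W) (UW : forall x, U x -> W (T x)).
Hypothesis smoothT : forall k, Ck 2 U (fun x => T x 0 k).
Hypotheses (smoothG : Ck_mx 1 U G) (smoothH : Ck_mx 1 W H).
Hypothesis symH : forall y, W y -> (H y)^T = H y.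

Let J x : 'M[R]_n := \matrix_(k, i) partial i (fun y => T y 0 k) x.

Hypothesis GE : forall x, U x -> G x = (J x)^T *m H (T x) *m J x.

Lemma Ck_jacobian : Ck_mx 1 U J.
Proof.
move=> k i; apply: Ck_ext (Ck_partial i (smoothT k)) => // x _.
by rewrite mxE.
Qed.

Lemma is_derive_transition (V : normedModType R) (c : V -> 'rV[R]_n) (t v : V)
    (dc : 'rV[R]_n) : U (c t) -> is_derive t v c dc ->
  is_derive t v (fun s => T (c s)) (J (c t) *m dc^T)^T.
Proof.
move=> Uc hc; apply/is_derive_mxP => i j; rewrite ord1 !mxE.
apply: is_derive_eq (is_derive_chain oU (smoothT j) Uc hc) _.
by apply: eq_bigr => l _; rewrite !mxE mulrC.
Qed.

Let K x := H (T x).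

(** The product rule for G = J^T (H o T) J. *)
Lemma direction_pullback x (u : 'cV[R]_n) : U x ->
  direction_mx G x u = (direction_mx J x u)^T *m K x *m J x
    + (J x)^T *m direction_mx H (T x) (J x *m u) *m J x
    + (J x)^T *m K x *m direction_mx J x u.
Proof.
move=> Ux.
have dG := is_derive_mx_direction u^T oU smoothG Ux.
have dJ := is_derive_mx_direction u^T oU Ck_jacobian Ux.
have dT := is_derive_transition (c := id) Ux (is_derive_id x u^T).
have dK := is_derive_mx_chain (c := T) oW smoothH (UW Ux) dT.
rewrite !trmxK in dG dJ dK.
have := is_derive_mulmx (is_derive_mulmx (is_derive_trmx dJ) dK) dJ.
move=> dG'; have [_ <-] := dG.
rewrite [RHS](_ : _ = ((direction_mx J x u)^T *m H (T x) +
  (J x)^T *m direction_mx H (T x) (J x *m u)) *m J x +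
  (J x)^T *m H (T x) *m direction_mx J x u); last by rewrite mulmxDl.
have [_ <-] := dG'; apply: near_eq_derive.
by apply: (open_near oU Ux) => y Uy; rewrite GE.
Qed.

(** Symmetry of the second derivatives of T: the derivative of J along u, applied to
    the l-th basis vector, is the l-th partial derivative of J applied to u. *)
Lemma direction_jacobianC x (u : 'cV[R]_n) k l : U x ->
  direction_mx J x u k l = \sum_i partial_mx l J x k i * u i 0.
Proof.
move=> Ux; rewrite direction_mxE; apply: eq_bigr => i _.
rewrite !mxE mulrC; congr (_ * _).
rewrite (_ : (fun y => J y k l) = partial l (fun y => T y 0 k)); last first.
  by apply/funext => y; rewrite mxE.
rewrite (_ : (fun y => J y k i) = partial i (fun y => T y 0 k)); last first.
  by apply/funext => y; rewrite mxE.
exact: partialC (smoothT k) Ux.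
Qed.

(** Covariance of the Euler-Lagrange expression.  The terms with second
    derivatives of T cancel because these are symmetric. *)
Lemma euler_lagrange_pullback x (u w : 'cV[R]_n) : U x ->
  euler_lagrange G x u w = (J x)^T *m
    euler_lagrange H (T x) (J x *m u) (J x *m w + direction_mx J x u *m u).
Proof.
move=> Ux; pose u' := J x *m u; rewrite -/u'.
have sK : (K x)^T = K x by rewrite symH //; exact: UW.
have dq l : (u^T *m partial_mx l G x *m u) 0 0 =
    2 * ((direction_mx J x u)^T *m (K x *m u')) l 0 +
    ((J x)^T *m \col_s ((u'^T *m partial_mx s H (T x) *m u') 0 0)) l 0.
  have E1 : ((direction_mx J x u)^T *m (K x *m u')) l 0 =
     ((u^T *m (partial_mx l J x)^T) *m (K x *m u')) 0 0.
    rewrite [LHS]mxE [RHS]mxE; apply: eq_bigr => k _; congr (_ * _).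
    rewrite mxE direction_jacobianC // mxE; apply: eq_bigr => i _.
    by rewrite [u^T 0 i]mxE [_^T i k]mxE mulrC.
  have E2 : ((J x)^T *m \col_s ((u'^T *m partial_mx s H (T x) *m u') 0 0)) l 0 =
     (u'^T *m direction_mx H (T x) (J x *m delta_mx l 0) *m u') 0 0.
    rewrite mxE /direction_mx mulmx_sumr mulmx_suml summxE.
    apply: eq_bigr => s _; rewrite [_^T l s]mxE [X in _ * X]mxE.
    by rewrite -scalemxAr -scalemxAl [RHS]mxE -colE [col _ _ _ _]mxE.
  have E3 : u^T *m partial_mx l G x *m u =
      u^T *m (partial_mx l J x)^T *m (K x *m u') +
      u'^T *m direction_mx H (T x) (J x *m delta_mx l 0) *m u' +
      (u^T *m (partial_mx l J x)^T *m (K x *m u'))^T.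
    rewrite -direction_mx_delta direction_pullback // direction_mx_delta.
    have -> : (u^T *m (partial_mx l J x)^T *m (K x *m u'))^T =
        u'^T *m K x *m (partial_mx l J x *m u).
      by rewrite !trmx_mul !trmxK sK !mulmxA.
    by rewrite /u' trmx_mul !mulmxDr !mulmxDl !mulmxA.
  rewrite E1 E2 E3; set P := u^T *m _ *m _; set Q := u'^T *m _ *m _.
  by rewrite [(P + Q + _) 0 0]mxE [(P + Q) 0 0]mxE [P^T 0 0]mxE; ring.
have qE : \col_l ((u^T *m partial_mx l G x *m u) 0 0) =
  2 *: ((direction_mx J x u)^T *m (K x *m u')) +
  (J x)^T *m \col_s ((u'^T *m partial_mx s H (T x) *m u') 0 0).
  by apply/colP => l; rewrite [LHS]mxE dq [RHS]mxE [X in _ = X + _]mxE.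
rewrite /euler_lagrange qE direction_pullback // GE // -/(K x).
rewrite scalerDr scalerA mulVf ?pnatr_eq0 // scale1r.
have alg (A B C D E : 'cV[R]_n) : A + (B + C + D) - (B + E) = A + D + C - E.
  by apply/colP => k; rewrite !mxE; ring.
rewrite !mulmxDl !mulmxDr mulmxN -scalemxAr /u' !mulmxA.
exact: alg.
Qed.

End Transformation.

(** * Existence of geodesics *)

Section GeodesicODE.
Variables (R : realType) (n : nat).

Lemma Ck_christoffel k (U : set 'rV[R]_n) (G : 'rV[R]_n -> 'M[R]_n) l i j :
  open U -> (forall x, U x -> G x \in unitmx) -> Ck_mx k.+1 U G ->
  Ck k U (christoffel G l i j).
Proof.
move=> oU uG hG; apply: Ck_scale => //; apply: Ck_sum => // m _.
apply: Ck_mul => //.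
  by apply: Ck_invmx => // a b; exact: CkW.
apply: Ck_sub => //; last exact: Ck_partial.
by apply: Ck_add => //; exact: Ck_partial.
Qed.

(** The second order equation as a first order system for the pair (x, v). *)
Lemma geodesic_ode (U : set 'rV[R]_n) (G : 'rV[R]_n -> 'M[R]_n) a (u : 'rV[R]_n) :
  open U -> (forall x, U x -> G x \in unitmx) -> Ck_mx 2 U G -> U a ->
  exists2 e : R, 0 < e & exists x v w : R -> 'rV[R]_n, [/\ x 0 = a, v 0 = u &
    forall t : R, `|t| < e -> [/\ U (x t), is_derive t 1 x (v t),
      is_derive t 1 v (w t) &
      forall k, w t 0 k + \sum_i \sum_j
        christoffel G k i j (x t) * v t 0 i * v t 0 j = 0]].
Proof.
move=> oU uG hG Ua.
pose acc (x v : 'rV[R]_n) : 'rV[R]_n :=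
  \row_k - (\sum_i \sum_j christoffel G k i j x * v 0 i * v 0 j).
pose f (z : 'rV[R]_(n + n)) : 'rV[R]_(n + n) :=
  row_mx (rsubmx z) (acc (lsubmx z) (rsubmx z)).
pose U2 := [set z : 'rV[R]_(n + n) | U (lsubmx z)].
have oU2 : open U2.
  apply: open_comp oU => z _; apply: continuous_rV => j.
  have cz := @coord_continuous R 1 (n + n) 0 (lshift n j) z.
  by apply: (continuous_eqfun _ cz) => y; rewrite mxE.
have Ck_l k j : Ck k U2 (fun z => lsubmx z 0 j).
  by apply: Ck_ext (Ck_coord k (lshift n j) oU2) => // z _; rewrite mxE.
have Ck_r k j : Ck k U2 (fun z => rsubmx z 0 j).
  by apply: Ck_ext (Ck_coord k (rshift n j) oU2) => // z _; rewrite mxE.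
have hf j : Ck 1 U2 (fun z => f z 0 j).
  have [k|k] := splitP j => jk.
    have -> : j = lshift n k by apply: val_inj.
    by apply: Ck_ext (Ck_r 1%N k) => // z _; rewrite row_mxEl.
  have -> : j = rshift n k by apply: val_inj.
  suff h : Ck 1 U2 (fun z => - (\sum_i \sum_j christoffel G k i j (lsubmx z) *
      rsubmx z 0 i * rsubmx z 0 j)).
    by apply: Ck_ext h => // z _; rewrite row_mxEr mxE.
  apply: Ck_opp => //; apply: Ck_sum => // i _; apply: Ck_sum => // j' _.
  apply: Ck_mul => //; apply: Ck_mul => //.
  apply: (@Ck_comp _ _ _ 1 U2 U (fun z => lsubmx z)) => //.
  exact: Ck_christoffel.
have Ua2 : U2 (row_mx a u) by rewrite /U2 /= row_mxKl.
have [e e0 [y y0 hy]] := ode_local oU2 hf Ua2.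
exists e => //; exists (fun t => lsubmx (y t)), (fun t => rsubmx (y t)),
  (fun t => acc (lsubmx (y t)) (rsubmx (y t))); split.
- by rewrite y0 row_mxKl.
- by rewrite y0 row_mxKr.
- move=> t /hy[Uy /is_derive_mxP dy]; split=> // [||k].
  + apply/is_derive_mxP => i j; rewrite ord1.
    have := dy 0 (lshift n j); rewrite row_mxEl => d.
    by apply: is_derive_eqfun d _ => s; rewrite mxE.
  + apply/is_derive_mxP => i j; rewrite ord1.
    have := dy 0 (rshift n j); rewrite row_mxEr => d.
    by apply: is_derive_eqfun d _ => s; rewrite mxE.
  + by rewrite mxE addNr.
Qed.

End GeodesicODE.

Section Charts.
Variables (R : realType) (n : nat) (M : topologicalType).
Variable S : smooth_structure R n M.
Implicit Types c : chart R n M.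

Definition overlap c c' : set 'rV[R]_n := c @` (chart_dom c `&` chart_dom c').

Lemma overlapP c c' x :
  overlap c c' x <-> chart_im c x /\ chart_dom c' (chart_inv c x).
Proof.
split=> [[p [pc pc'] <-]|[[p pc <-]]]; first by split; [exists p|rewrite chart_mapK].
by rewrite chart_mapK // => pc'; exists p.
Qed.

Lemma overlap_open c c' : open (overlap c c').
Proof.
have -> : overlap c c' = chart_im c `&` chart_inv c @^-1` chart_dom c'.
  by apply/seteqP; split=> x /overlapP.
rewrite openE => x [xc xc'].
have h1 : nbhs x (chart_im c) by apply: open_nbhs_nbhs; split=> //; exact: chart_im_open.
have h2 : nbhs x (chart_inv c @^-1` chart_dom c').
  apply: (chart_inv_continuous xc); apply: open_nbhs_nbhs; split=> //.
  exact: chart_dom_open.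
exact: filterI h1 h2.
Qed.

(** Two coordinate systems are each compatible with the atlas only; near a given
    point the transition between them factors through a chart a of the atlas. *)
Lemma smooth_transition_coordinates c c' : coordinate_system S c ->
  coordinate_system S c' -> smooth_transition c c'.
Proof.
move=> hc hc' k m; apply: Ck_local => x xcc'.
have /overlapP[xc xc'] : overlap c c' x by [].
have [a aA pa] := atlas_cover S (chart_inv c x).
pose U := overlap c a `&` overlap c c'.
have oU : open U by apply: openI; exact: overlap_open.
exists U; first by split=> //; apply/overlapP.
have T1 j : Ck m (overlap c a) (transition c a j) by exact: (hc a aA).1.
have T2 : Ck m (overlap a c') (transition a c' k) by exact: (hc' a aA).2.
pose T y : 'rV[R]_n := \row_j transition c a j y.
have TE y : T y = a (chart_inv c y) by apply/rowP => j; rewrite mxE.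
have h : Ck m U (fun y => transition a c' k (T y)).
  apply: (Ck_comp (W := overlap a c')) => //.
  - exact: overlap_open.
  - move=> y [/overlapP[yc ya] /overlapP[_ yc']]; rewrite TE.
    by exists (chart_inv c y).
  - move=> j; apply: Ck_ext (Ck_subset _ (T1 j)) => // [y _|y []//].
    by rewrite mxE.
apply: Ck_ext h => // y [/overlapP[yc ya] _].
by rewrite /transition TE chart_mapK.
Qed.

End Charts.

Section Geodesics.
Variables (R : realType) (n : nat) (M : topologicalType).
Variable S : smooth_structure R n M.
Implicit Types (c : chart R n M) (g : metric S).

Lemma metric_Ck_mx g c k : coordinate_system S c -> Ck_mx k (chart_im c) (g c).
Proof. by move=> hc i j; exact: metric_smooth. Qed.

(** By [euler_lagrange_pullback], since the jacobian J is invertible.  The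
    acceleration in the new coordinates is J w plus the derivative of J along v
    applied to v. *)
Lemma geodesic_in_chart g c c' (x v w : R -> 'rV[R]_n) (e : R) :
  coordinate_system S c -> coordinate_system S c' ->
  (forall t : R, `|t| < e -> [/\ chart_im c (x t), is_derive t 1 x (v t),
      is_derive t 1 v (w t) &
      forall k, w t 0 k + \sum_i \sum_j
        christoffel (g c) k i j (x t) * v t 0 i * v t 0 j = 0]) ->
  forall t : R, `|t| < e -> chart_dom c' (chart_inv c (x t)) ->
  let y k := fun s : R => c' (chart_inv c (x s)) 0 k in
  forall k, [/\ derivable (y k) t 1, derivable (derive1 (y k)) t 1 &
    derive1 (derive1 (y k)) t + \sum_i \sum_j
      christoffel (g c') k i j (c' (chart_inv c (x t))) *
        derive1 (y i) t * derive1 (y j) t = 0].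
Proof.
move=> hc hc' hx t te c't y.
pose U := overlap c c'; pose W := overlap c' c.
have oU : open U by exact: overlap_open.
have oW : open W by exact: overlap_open.
pose T (z : 'rV[R]_n) : 'rV[R]_n := c' (chart_inv c z).
have UW z : U z -> W (T z).
  by move=> /overlapP[zc zc']; exists (chart_inv c z) => //; split=> //;
    case: zc => p pc <-; rewrite chart_mapK.
have smoothT k : Ck 2 U (fun z => T z 0 k).
  exact: (smooth_transition_coordinates hc hc' k 2%N).
have smoothG : Ck_mx 1 U (g c).
  by move=> i j; apply: Ck_subset (metric_Ck_mx g 1 hc i j) => z /overlapP[].
have smoothH : Ck_mx 1 W (g c').
  by move=> i j; apply: Ck_subset (metric_Ck_mx g 1 hc' i j) => z /overlapP[].
have symH z : W z -> (g c' z)^T = g c' z.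
  by move=> /overlapP[zW _]; exact: (Defs.metric_sym g hc' zW).
pose J z : 'M[R]_n := \matrix_(k, i) partial i (fun y => T y 0 k) z.
have GE z : U z -> g c z = (J z)^T *m g c' (T z) *m J z.
  by move=> [p [pc pc'] <-]; rewrite (metric_tensorial g hc hc' pc pc') /T chart_mapK.
have Ux s : `|s| < e -> chart_dom c' (chart_inv c (x s)) -> U (x s).
  by move=> /hx[xs _ _ _] ?; apply/overlapP.
have Uxt := Ux t te c't.
have near_t : \forall s \near t, `|s| < e /\ U (x s).
  apply: filterI; first exact: near_norm_lt.
  have [_ dx _ _] := hx t te.
  have cx : {for t, continuous x} by apply/differentiable_continuous/derivable1_diffP.
  by apply: cx; exact: open_nbhs_nbhs.
have dy s : `|s| < e -> U (x s) -> is_derive s 1 (fun s => T (x s)) (J (x s) *m (v s)^T)^T.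
  move=> se Us; have [_ dx _ _] := hx s se.
  exact: (is_derive_transition oU smoothT Us dx).
have dyk k s : `|s| < e -> U (x s) ->
    is_derive s 1 (y k) ((J (x s) *m (v s)^T) k 0).
  move=> se Us; have /is_derive_mxP /(_ 0 k) := dy s se Us.
  by rewrite mxE.
have y1 k : \forall s \near t, (J (x s) *m (v s)^T) k 0 = derive1 (y k) s.
  apply: filterS near_t => s [se Us].
  by have [_ <-] := dyk k s se Us; rewrite derive1E.
pose u' := J (x t) *m (v t)^T.
pose w' := J (x t) *m (w t)^T + direction_mx J (x t) (v t)^T *m (v t)^T.
have d2 k : is_derive t 1 (derive1 (y k)) (w' k 0).
  apply: near_eq_is_derive (y1 k) _.
  have [_ dx dv _] := hx t te.
  have dJ := is_derive_mx_chain oU (Ck_jacobian oU smoothT) Uxt dx.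
  have /is_derive_mxP := is_derive_mulmx dJ (is_derive_trmx dv).
  by move=> /(_ k 0) h; apply: is_derive_eq h _; rewrite addrC.
have u'E k : derive1 (y k) t = u' k 0 by rewrite -(nbhs_singleton (y1 k)).
have EL0 : euler_lagrange (g c) (x t) (v t)^T (w t)^T = 0.
  have [xt _ _ gx] := hx t te.
  apply/christoffel_euler_lagrange => [|i|k]; first exact: (metric_nondeg g hc xt).
    apply: partial_mx_sym oU _ Uxt => z /overlapP[zc _]; exact: (Defs.metric_sym g hc zc).
  rewrite mxE -[RHS](gx k); congr (_ + _).
  by apply: eq_bigr => i _; apply: eq_bigr => j _; rewrite !mxE.
have EL' : euler_lagrange (g c') (T (x t)) u' w' = 0.
  have uJ : (J (x t))^T \in unitmx.
    have [xt _ _ _] := hx t te.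
    have := metric_nondeg g hc xt.
    by rewrite GE // !unitmx_mul => /andP[/andP[]].
  have := euler_lagrange_pullback oU oW UW smoothT smoothG smoothH symH GE
    (v t)^T (w t)^T Uxt.
  by rewrite EL0 => /(congr1 (mulmx (invmx (J (x t))^T))); rewrite mulmx0 mulKmx.
have Wx : W (T (x t)) by exact: UW.
have gy : forall k, w' k 0 + \sum_i \sum_j
    christoffel (g c') k i j (T (x t)) * u' i 0 * u' j 0 = 0.
  apply/christoffel_euler_lagrange => //.
    by have /overlapP[Wc _] := Wx; exact: (metric_nondeg g hc' Wc).
  by move=> i; apply: partial_mx_sym oW symH Wx.
move=> k; have [dk1 _] := dyk k t te Uxt; have [dk2 dk2E] := d2 k; split=> //.
rewrite -[RHS](gy k); congr (_ + _); first by rewrite -dk2E derive1E.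
by apply: eq_bigr => i _; apply: eq_bigr => j _; rewrite !u'E.
Qed.

Lemma geodesic_exists g c a (u : 'rV[R]_n) : coordinate_system S c -> chart_im c a ->
  exists2 e : R, 0 < e & exists x v w : R -> 'rV[R]_n,
    [/\ x 0 = a, v 0 = u, geodesic g [set t : R | `|t| < e] (chart_inv c \o x) &
    forall t : R, `|t| < e -> [/\ chart_im c (x t), is_derive t 1 x (v t),
      is_derive t 1 v (w t) &
      forall k, w t 0 k + \sum_i \sum_j
        christoffel (g c) k i j (x t) * v t 0 i * v t 0 j = 0]].
Proof.
move=> hc ca.
have [e e0 [x [v [w [x0 v0 hx]]]]] := geodesic_ode u (@chart_im_open _ _ _ c)
  (metric_nondeg g hc) (metric_Ck_mx g 2 hc) ca.
exists e => //; exists x, v, w; split=> //; split=> [t te|t te c' hc' c't].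
  have [xt dx _ _] := hx t te.
  apply: continuous_comp; last exact: chart_inv_continuous.
  by apply/differentiable_continuous/derivable1_diffP.
exact: geodesic_in_chart hc hc' hx t te c't.
Qed.

End Geodesics.

(** * The theorem of Weyl *)

Section Weyl.
Variables (R : realType) (n : nat).

Lemma quadratic_two (D : 'I_n -> 'I_n -> R) (i j : 'I_n) (s : R) :
  i != j -> (forall p q, D p q = D q p) ->
  let u k := (k == i)%:R + s * (k == j)%:R in
  \sum_p \sum_q D p q * u p * u q = D i i + 2 * s * D i j + s ^+ 2 * D j j.
Proof.
move=> ij symD u.
have sum_u (f : 'I_n -> R) : \sum_q f q * u q = f i + s * f j.
  have -> : \sum_q f q * u q = \sum_q (f q * (q == i)%:R + s * (f q * (q == j)%:R)).
    by apply: eq_bigr => q _; rewrite /u; ring.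
  have pick k : \sum_q f q * (q == k)%:R = f k.
    rewrite (bigD1 k) //= eqxx mulr1 big1 ?addr0 // => q qk.
    by rewrite (negbTE qk) mulr0.
  by rewrite big_split /= -mulr_sumr !pick.
have -> : \sum_p \sum_q D p q * u p * u q = \sum_p (D p i + s * D p j) * u p.
  apply: eq_bigr => p _; rewrite -sum_u mulr_suml.
  by apply: eq_bigr => q _; ring.
by rewrite sum_u (symD j i); ring.
Qed.

(** Testing u = e_i and u = e_i + e_j, e_i - e_j suffices: proportionality forces
    the components of D(u,u) outside of i and j to vanish, and the components i
    and j to stand in the ratio of those of u. *)
Lemma symmetric_projective (D : 'I_n -> 'I_n -> 'I_n -> R) :
  (forall k i j, D k i j = D k j i) ->
  (forall u : 'I_n -> R, exists l, forall k,
     \sum_i \sum_j D k i j * u i * u j = l * u k) ->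
  exists phi : 'I_n -> R, forall k i j,
    D k i j = (k == i)%:R * phi j + (k == j)%:R * phi i.
Proof.
move=> symD hD; exists (fun i => D i i i / 2).
have two (i j : 'I_n) (s : R) : i != j -> exists l, forall k,
    D k i i + 2 * s * D k i j + s ^+ 2 * D k j j = l * ((k == i)%:R + s * (k == j)%:R).
  move=> ij; have [l hl] := hD (fun k => (k == i)%:R + s * (k == j)%:R).
  by exists l => k; rewrite -hl quadratic_two.
have diag k i : k != i -> D k i i = 0.
  move=> ki; have ik : i != k by rewrite eq_sym.
  have [l hl] := two i k 0 ik.
  have := hl k; rewrite (negbTE ki) eqxx => h.
  by move: h; rewrite expr0n /= !(mulr0, mul0r, addr0).
move=> k i j; have [<-{j}|ij] := eqVneq i j.
  have [->|ki] := eqVneq k i; first by rewrite !mul1r -splitr.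
  by rewrite diag // !mul0r addr0.
have [l1 h1] := two i j 1 ij; have [l2 h2] := two i j (-1) ij.
have Dii : D i i j = D j j j / 2.
  have := h1 i; have := h1 j; have := h2 i; have := h2 j.
  rewrite !eqxx (negbTE ij) eq_sym (negbTE ij) (diag i j) // (diag j i) 1?eq_sym //.
  by move=> *; lra.
have Djj : D j i j = D i i i / 2.
  have := h1 i; have := h1 j; have := h2 i; have := h2 j.
  rewrite !eqxx (negbTE ij) eq_sym (negbTE ij) (diag i j) // (diag j i) 1?eq_sym //.
  by move=> *; lra.
have [->|ki] := eqVneq k i.
  by rewrite (negbTE ij) Dii mul1r mul0r addr0.
have [->|kj] := eqVneq k j; first by rewrite Djj mul0r mul1r add0r.
have := h1 k; rewrite (negbTE ki) (negbTE kj) diag // diag //.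
by rewrite -[false%:R]/(0 : R) => h; lra.
Qed.

End Weyl.

Section GeodesicEquivalence.
Variables (R : realType) (n : nat) (M : topologicalType).
Variable S : smooth_structure R n M.
Implicit Types (c : chart R n M) (g h : metric S).

Lemma ball0_open_interval (e : R) : open_interval [set t : R | `|t| < e].
Proof.
split.
  rewrite openE => t te; exact: near_norm_lt.
move=> x y /=; rewrite !ltr_norml => /andP[x1 x2] /andP[y1 y2] z /andP[xz zy].
by rewrite ltr_norml (lt_le_trans x1 xz) (le_lt_trans zy y2).
Qed.

(** Along a g-geodesic x with a reparametrisation x o tau that is an
    h-geodesic, both geodesic equations hold at the same point; eliminating the
    acceleration leaves a multiple tau'' / tau'^2 of the velocity. *)
Lemma christoffel_difference_parallel g h c a (u : 'I_n -> R) :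
  geodesics_among g h -> coordinate_system S c -> chart_im c a ->
  exists l, forall k, \sum_i \sum_j
    (christoffel (h c) k i j a - christoffel (g c) k i j a) * u i * u j = l * u k.
Proof.
move=> gh hc ca; pose uv : 'rV[R]_n := \row_k u k.
have [e e0 [x [v [w [x0 v0 geo hx]]]]] := geodesic_exists g uv hc ca.
have [J [tau [[oJ _] [bij dtau] [_ geoh]]]] := gh _ _ (ball0_open_interval e) geo.
have tauJ s : J s -> `|tau s| < e by move=> Js; have [f _ _] := bij; exact: f.
have I0 : [set t : R | `|t| < e] 0 by rewrite /= normr0.
have [s0 Js0 t0] : exists2 s, J s & tau s = 0.
  by have [_ _ sj] := bij; have [s Js ts] := sj 0 I0; exists s.
have nJ : \forall s \near s0, J s by exact: open_nbhs_nbhs.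
have dom0 : chart_dom c ((chart_inv c \o x \o tau) s0).
  by rewrite /= t0 x0; case: ca => p pc <-; rewrite chart_mapK.
pose y k := fun s : R => c ((chart_inv c \o x \o tau) s) 0 k.
have yE k s : J s -> y k s = x (tau s) 0 k.
  move=> Js; have [[p pc E] _ _ _] := hx _ (tauJ s Js).
  by rewrite /y /= -E chart_mapK.
pose t1 := derive1 tau s0; pose t2 := derive1 (derive1 tau) s0.
have dtau1 s : J s -> is_derive s 1 tau (derive1 tau s).
  by move=> /dtau[d _]; rewrite derive1E; apply: DeriveDef => //; exact: (d 0%N).
have dtau2 : is_derive s0 1 (derive1 tau) t2.
  by have [d _] := dtau _ Js0; rewrite /t2 derive1E; apply: DeriveDef => //; exact: (d 1%N).
have dcomp (z dz : R -> 'rV[R]_n) k s : J s -> is_derive (tau s) 1 z (dz (tau s)) ->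
    is_derive s 1 (fun s => z (tau s) 0 k) (dz (tau s) 0 k * derive1 tau s).
  move=> Js /is_derive_mxP /(_ 0 k) d.
  have dt := dtau1 s Js.
  exact: (@is_derive1_comp _ (fun t => z t 0 k) tau).
have dy k s : J s -> is_derive s 1 (y k) (v (tau s) 0 k * derive1 tau s).
  move=> Js; have [_ dx _ _] := hx _ (tauJ s Js).
  apply: near_eq_is_derive (dcomp x v k s Js dx).
  have nJs : \forall s' \near s, J s' by exact: open_nbhs_nbhs.
  by apply: filterS nJs => s' Js'; rewrite yE.
have y1 k : \forall s \near s0, v (tau s) 0 k * derive1 tau s = derive1 (y k) s.
  by apply: filterS nJ => s Js; have [_ <-] := dy k s Js; rewrite derive1E.
have y1E k : derive1 (y k) s0 = u k * t1.
  by rewrite -(nbhs_singleton (y1 k)) t0 v0 mxE.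
have y2E k : derive1 (derive1 (y k)) s0 = w 0 0 k * t1 * t1 + u k * t2.
  rewrite derive1E -(near_eq_derive _ (y1 k)).
  have [_ _ dv _] := hx _ (tauJ _ Js0).
  have [_ ->] := is_derive_mul (dcomp v w k s0 Js0 dv) dtau2.
  by rewrite t0 v0 mxE.
have geoE k := geoh s0 Js0 c hc dom0 k.
have cE : c ((chart_inv c \o x \o tau) s0) = a.
  by rewrite /= t0 x0; case: ca => p pc <-; rewrite chart_mapK.
have t1n : t1 != 0 by have [] := dtau _ Js0.
exists (- t2 / t1 ^+ 2) => k.
have [_ _ E] := geoE k; move: E; rewrite -/(y k).
rewrite (_ : derive1 (derive1 (y k)) s0 = w 0 0 k * t1 * t1 + u k * t2) //.
rewrite cE.
have -> : \sum_i \sum_j christoffel (h c) k i j a * derive1 (y i) s0 * derive1 (y j) s0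
  = t1 ^+ 2 * \sum_i \sum_j christoffel (h c) k i j a * u i * u j.
  rewrite mulr_sumr; apply: eq_bigr => i _; rewrite mulr_sumr; apply: eq_bigr => j _.
  by rewrite !y1E; ring.
have I0' : `|0 : R| < e by rewrite normr0.
have [_ _ _ /(_ k)] := hx 0 I0'; rewrite x0 v0.
have -> : \sum_i \sum_j christoffel (g c) k i j a * uv 0 i * uv 0 j =
   \sum_i \sum_j christoffel (g c) k i j a * u i * u j.
  by apply: eq_bigr => i _; apply: eq_bigr => j _; rewrite !mxE.
have -> : \sum_i \sum_j (christoffel (h c) k i j a - christoffel (g c) k i j a) * u i * u j
  = \sum_i \sum_j christoffel (h c) k i j a * u i * u j -
    \sum_i \sum_j christoffel (g c) k i j a * u i * u j.
  rewrite -sumrB; apply: eq_bigr => i _; rewrite -sumrB; apply: eq_bigr => j _.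
  by ring.
move: (\sum_i _) (\sum_i _) => B A wA wB.
have {wA} wA : w 0 0 k = - A by apply/eqP; rewrite -addr_eq0 wA.
have {wB} wB : - A * t1 * t1 + u k * t2 + t1 ^+ 2 * B = 0 by rewrite -wA.
apply: (mulfI (expf_neq0 2 t1n)).
have -> : t1 ^+ 2 * (- t2 / t1 ^+ 2 * u k) = - (u k * t2) by field.
by apply/eqP; rewrite -subr_eq0 opprK -wB; apply/eqP; ring.
Qed.

Lemma christoffelC (U : set 'rV[R]_n) (G : 'rV[R]_n -> 'M[R]_n) a k i j :
  open U -> (forall x, U x -> (G x)^T = G x) -> U a ->
  christoffel G k i j a = christoffel G k j i a.
Proof.
move=> oU sG Ua; rewrite /christoffel; congr (_ * _); apply: eq_bigr => l _.
have /matrixP /(_ j i) := partial_mx_sym l oU sG Ua; rewrite !mxE => ->.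
by congr (_ * (_ - _)); exact: addrC.
Qed.

Lemma weyl g h c a : geodesics_among g h -> coordinate_system S c -> chart_im c a ->
  exists phi : 'rV[R]_n, forall k i j, christoffel (h c) k i j a =
    christoffel (g c) k i j a + (k == i)%:R * phi 0 j + (k == j)%:R * phi 0 i.
Proof.
move=> gh hc ca; have oU := @chart_im_open _ _ _ c.
have [|u|phi hphi] := @symmetric_projective R n (fun k i j =>
    christoffel (h c) k i j a - christoffel (g c) k i j a).
- move=> k i j.
  by rewrite (christoffelC _ _ _ oU (Defs.metric_sym h hc)) //
    (christoffelC _ _ _ oU (Defs.metric_sym g hc)).
- exact: christoffel_difference_parallel.
- exists (\row_k phi k) => k i j; rewrite !mxE -addrA -hphi.
  by rewrite addrC subrK.
Qed.

End GeodesicEquivalence.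

(** * Derivatives of determinants, inverses and real roots *)

Section Determinant.
Variables (R : realType) (V : normedModType R).

Lemma is_derive_prod (I : eqType) (r : seq I) (F : I -> V -> R) (dF : I -> R) x v :
  uniq r -> (forall i, is_derive x v (F i) (dF i)) ->
  is_derive x v (fun y => \prod_(i <- r) F i y)
    (\sum_(i <- r) dF i * \prod_(j <- r | j != i) F j x).
Proof.
move=> ur hF; elim: r ur => [_|a r IH /= /andP[ar ur]].
  rewrite big_nil; apply: is_derive_eqfun (is_derive_cst (1 : R) x v) _.
  by move=> y; rewrite big_nil.
apply: is_derive_eqfun (_ : is_derive x v (fun y => F a y * \prod_(i <- r) F i y) _) _;
  last by move=> y; rewrite big_cons.
apply: is_derive_eq (is_derive_mul (hF a) (IH ur)) _.
rewrite big_cons big_cons eqxx /=; congr (_ + _).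
  congr (_ * _); rewrite big_seq [RHS]big_seq_cond; apply: eq_bigl => j.
  by case: (boolP (j \in r)) => //= jr; apply/esym; apply: contraNneq ar => <-.
rewrite mulr_sumr [LHS]big_seq [RHS]big_seq; apply: eq_bigr => i ir.
have ai : a != i by apply: contraNneq ar => ->.
rewrite big_cons ai; exact: mulrCA.
Qed.

(** In the Leibniz formula, only the identity permutation contributes to the
    derivative at the identity matrix. *)
Lemma is_derive_det_at1 n (A : V -> 'M[R]_n) x v dA : A x = 1%:M ->
  is_derive x v A dA -> is_derive x v (fun y => \det (A y)) (\tr dA).
Proof.
move=> A1 /is_derive_mxP hA.
pose d (s : 'S_n) := \sum_i dA i (s i) * \prod_(j | j != i) A x j (s j).
have hd (s : 'S_n) : is_derive x v (fun y => \prod_i A y i (s i)) (d s).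
  by apply: is_derive_prod; exact: index_enum_uniq.
have d1 : d 1%g = \tr dA.
  apply: eq_bigr => i _; rewrite perm1 big1 ?mulr1 // => j _.
  by rewrite perm1 A1 mxE eqxx.
(* A permutation moving one index moves a second one. *)
have dn (s : 'S_n) : s != 1%g -> d s = 0.
  move=> s1; apply: big1 => i _.
  have [j ji sj] : exists2 j, j != i & s j != j.
    have [sii|sii] := eqVneq (s i) i; last first.
      by exists (s i) => //; rewrite (inj_eq perm_inj).
    have /existsP[j sj] : [exists j, s j != j].
      apply: contraT; rewrite negb_exists => /forallP h; case/eqP: s1.
      by apply/permP => j; rewrite perm1; apply/eqP; move: (h j); rewrite negbK.
    by exists j => //; apply: contraNneq sj => ->; rewrite sii.
  by rewrite (bigD1 j) //= A1 mxE eq_sym (negbTE sj) mul0r mulr0.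
have -> : \tr dA = \sum_(s : 'S_n) (-1) ^+ s * d s.
  rewrite (bigD1 1%g) //= odd_perm1 mul1r d1 big1 ?addr0 // => s s1.
  by rewrite dn // mulr0.
have hs (s : 'S_n) :
    is_derive x v (fun y => (-1) ^+ s * \prod_i A y i (s i)) ((-1) ^+ s * d s).
  apply: is_derive_eq (is_derive_mul (is_derive_cst ((-1 : R) ^+ s) x v) (hd s)) _.
  by rewrite mul0r add0r.
by apply: is_derive_bigsum.
Qed.

(** Reduction to the derivative at the identity matrix, dividing by A x. *)
Lemma is_derive_det n (A : V -> 'M[R]_n) x v dA : A x \in unitmx ->
  is_derive x v A dA ->
  is_derive x v (fun y => \det (A y)) (\det (A x) * \tr (invmx (A x) *m dA)).
Proof.
move=> uA hA.
have hB := is_derive_mulmx (is_derive_cst (invmx (A x)) x v) hA.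
have := is_derive_det_at1 (A := fun y => invmx (A x) *m A y) (mulVmx uA) hB.
rewrite mul0mx add0r => hd.
have := is_derive_mul (is_derive_cst (\det (A x)) x v) hd.
rewrite mul0r add0r => h; apply: is_derive_eqfun h _ => y.
by rewrite -det_mulmx mulmxA mulmxV // mul1mx.
Qed.

Lemma is_derive_comp_real (f : R -> R) (q : V -> R) x v df dq :
  is_derive (q x) 1 f df -> is_derive x v q dq ->
  is_derive x v (fun y => f (q y)) (df * dq).
Proof.
move=> hf /is_derive_at0 hq; apply/is_derive_at0.
have hf' : is_derive (q (0 *: v + x)) 1 f df by rewrite scale0r add0r.
exact: (@is_derive1_comp _ f (fun h : R => q (h *: v + x))).
Qed.

(** For q < 0 by oddness of the root. *)
Lemma is_derive_real_root m (q : R) : q != 0 ->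
  is_derive q 1 (real_root m) (real_root m q / (m%:R * q)).
Proof.
have pos (p : R) : 0 < p -> is_derive p 1 (real_root m) (real_root m p / (m%:R * p)).
  move=> p0; have h := is_derive1_powR (m%:R^-1) p0.
  have h' : is_derive p 1 (fun y : R => y `^ m%:R^-1) (real_root m p / (m%:R * p)).
    apply: is_derive_eq h _.
    rewrite /real_root gtr0_sg // mul1r gtr0_norm // powRB; last by rewrite (gt_eqF p0) implybT.
    by rewrite (powRr1 (ltW p0)) invfM; ring.
  apply: near_eq_is_derive h'.
  have : \forall y \near p, 0 < y by apply: lt_nbhsr.
  by apply: filterS => y y0; rewrite /real_root gtr0_sg // mul1r gtr0_norm.
move=> q0; have [q1|q1] := ltP 0 q; first exact: pos.
have {}q1 : 0 < - q by rewrite oppr_gt0 lt_neqAle q0.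
have rN (y : R) : real_root m y = - real_root m (- y).
  by rewrite /real_root sgrN normrN mulNr opprK.
have h1 := is_derive_opp (is_derive_id q (1 : R)).
have h2 := is_derive_opp (@is_derive1_comp _ (real_root m) (fun y : R => - y) q _ _ (pos _ q1) h1).
apply: is_derive_eq (is_derive_eqfun h2 _) _ => [y|]; first by rewrite [RHS]rN.
by rewrite (rN q) !mulrN !mulr1 invrN mulrN mulNr !opprK.
Qed.

End Determinant.

Section InverseMatrix.
Variables (R : realType) (n : nat).

(** Differentiability comes from [Ck_invmx]; the value then follows by
    differentiating A *m invmx A = 1. *)
Lemma is_derive_invmx (U : set 'rV[R]_n) m (A : 'rV[R]_n -> 'M[R]_m) a
    (v : 'rV[R]_n) : open U -> Ck_mx 1 U A -> (forall x, U x -> A x \in unitmx) ->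
  U a -> is_derive a v (fun y => invmx (A y))
    (- (invmx (A a) *m direction_mx A a v^T *m invmx (A a))).
Proof.
move=> oU hA uA Ua.
have hV : Ck_mx 1 U (fun y => invmx (A y)) by move=> i j; exact: Ck_invmx.
have dA := is_derive_mx_direction v oU hA Ua.
have dV := is_derive_mx_direction v oU hV Ua.
have [_ h] := is_derive_mulmx dA dV.
apply: is_derive_eq dV _; move: h; set D := direction_mx _ _ _ => h.
have h0 : 'D_v (fun y => A y *m invmx (A y)) a = 0.
  rewrite (near_eq_derive (g := cst 1%:M)) ?derive_cst //.
  by apply: (open_near oU Ua) => y Uy; rewrite mulmxV // uA.
move: h; rewrite h0 => /esym/eqP; rewrite addrC addr_eq0 => /eqP E.
by rewrite -[LHS](mulKmx (uA a Ua)) E mulmxN mulmxA.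
Qed.

End InverseMatrix.

(** * The Sinjukov equation and the Nijenhuis torsion *)

Section ProjectivelyRelated.
Variables (R : realType) (n : nat).
Variables (U : set 'rV[R]_n) (G H : 'rV[R]_n -> 'M[R]_n).
Hypotheses (oU : open U) (hG : Ck_mx 1 U G) (hH : Ck_mx 1 U H).
Hypotheses (sG : forall x, U x -> (G x)^T = G x) (sH : forall x, U x -> (H x)^T = H x).
Hypotheses (uG : forall x, U x -> G x \in unitmx) (uH : forall x, U x -> H x \in unitmx).

(** The connection form: v |-> Gamma (u, v) as a matrix. *)
Definition connection (K : 'rV[R]_n -> 'M[R]_n) a (u : 'cV[R]_n) : 'M[R]_n :=
  \matrix_(k, j) \sum_i u i 0 * christoffel K k i j a.

Lemma connectionC K a (u v : 'cV[R]_n) : (forall x, U x -> (K x)^T = K x) -> U a ->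
  connection K a u *m v = connection K a v *m u.
Proof.
move=> sK Ua; apply/colP => k; rewrite !mxE.
under eq_bigr do rewrite mxE mulr_suml.
under [RHS]eq_bigr do rewrite mxE mulr_suml.
rewrite exchange_big; apply: eq_bigr => i _; apply: eq_bigr => j _.
by rewrite (christoffelC _ _ _ oU sK Ua); ring.
Qed.

(** This is the metric property of the Levi-Civita connection.  Twice the entry
    (m, j) of K C, for the connection form C of u, is the derivative of K_mj along
    u plus two terms antisymmetric in m and j, which the transpose cancels. *)
Lemma direction_metric K a (u : 'cV[R]_n) : (forall x, U x -> (K x)^T = K x) ->
  (forall x, U x -> K x \in unitmx) -> U a ->
  direction_mx K a u = (connection K a u)^T *m K a + K a *m connection K a u.
Proof.
move=> sK uK Ua.
have sp i k l : partial i (fun y => K y k l) a = partial i (fun y => K y l k) a.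
  by have /matrixP /(_ l k) := partial_mx_sym i oU sK Ua; rewrite !mxE.
pose B : 'M[R]_n := \matrix_(m, j) \sum_i u i 0 *
  (partial i (fun y => K y j m) a + partial j (fun y => K y i m) a
   - partial m (fun y => K y i j) a).
have E : K a *m connection K a u = 2^-1 *: B.
  have -> : connection K a u = invmx (K a) *m (2^-1 *: B).
    apply/matrixP => k j; rewrite !mxE.
    under eq_bigr do rewrite /christoffel mulrCA mulr_sumr.
    under [RHS]eq_bigr do rewrite mxE mxE mulrCA mulr_sumr.
    rewrite -!mulr_sumr; congr (_ * _); rewrite exchange_big.
    apply: eq_bigr => l _; apply: eq_bigr => i _.
    by ring.
  by rewrite mulKVmx // uK.
have -> : (connection K a u)^T *m K a = (K a *m connection K a u)^T.
  by rewrite trmx_mul sK.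
rewrite E; apply/matrixP => k l; rewrite direction_mxE !mxE -mulrDr -big_split mulr_sumr.
apply: eq_bigr => i _ /=.
rewrite (sp i l k) (sp k i l) (sp l i k) (sp k l i).
by field.
Qed.

(** The trace of the connection form is the logarithmic derivative of
    sqrt |det K|. *)
Lemma is_derive_det_metric K a (u : 'cV[R]_n) : (forall x, U x -> (K x)^T = K x) ->
  (forall x, U x -> K x \in unitmx) -> Ck_mx 1 U K -> U a ->
  is_derive a u^T (fun y => \det (K y)) (\det (K a) * (2 * \tr (connection K a u))).
Proof.
move=> sK uK hK Ua.
have := is_derive_det (uK a Ua) (is_derive_mx_direction u^T oU hK Ua).
rewrite trmxK direction_metric // => h; apply: is_derive_eq h _; congr (_ * _).
rewrite mulmxDr mxtraceD mulKmx ?uK // mulmxA mxtrace_mulC mulmxA.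
by rewrite mulmxV ?uK // mul1mx mxtrace_tr; ring.
Qed.

Variable a : 'rV[R]_n.
Hypothesis Ua : U a.
Variable phi : 'rV[R]_n.
Hypothesis weylGH : forall k i j, christoffel H k i j a =
  christoffel G k i j a + (k == i)%:R * phi 0 j + (k == j)%:R * phi 0 i.

Lemma connection_weyl (u : 'cV[R]_n) : connection H a u =
  connection G a u + ((phi *m u) 0 0)%:M + u *m phi.
Proof.
apply/matrixP => k j; rewrite !mxE.
under eq_bigr do rewrite weylGH 2!mulrDr.
rewrite !big_split /= -!addrA; congr (_ + _); rewrite addrC; congr (_ + _).
  rewrite -[RHS]mulr_natl mulr_sumr; apply: eq_bigr => i _.
  by ring.
rewrite (bigD1 k) //= eqxx mul1r big1 ?addr0; last first.
  by move=> i ik; rewrite eq_sym (negbTE ik) mul0r mulr0.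
by rewrite big_ord1.
Qed.

Definition ratio_root (y : 'rV[R]_n) : R := real_root n.+1 (\det (H y) / \det (G y)).

(** The tensor L of two metrics on a manifold, in coordinates, is this expression
    for the two matrices of components. *)
Definition projective_tensor (y : 'rV[R]_n) : 'M[R]_n :=
  ratio_root y *: (invmx (H y) *m G y).

Local Notation L := projective_tensor.
Local Notation w := (ratio_root a *: (invmx (H a) *m phi^T)).

(** By the trace of Weyl's formula, the logarithmic derivative of det H / det G
    along u is 2 (n + 1) phi(u). *)
Lemma is_derive_ratio_root (u : 'cV[R]_n) :
  is_derive a u^T ratio_root (2 * (phi *m u) 0 0 * ratio_root a).
Proof.
have dG := is_derive_det_metric u sG uG hG Ua.
have dH := is_derive_det_metric u sH uH hH Ua.
have G0 : \det (G a) != 0 by have := uG Ua; rewrite unitmxE unitfE.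
have H0 : \det (H a) != 0 by have := uH Ua; rewrite unitmxE unitfE.
have q0 : \det (H a) / \det (G a) != 0 by rewrite mulf_neq0 ?invr_eq0.
have tr : \tr (connection H a u) =
    \tr (connection G a u) + n.+1%:R * (phi *m u) 0 0.
  rewrite connection_weyl !mxtraceD mxtrace_scalar mxtrace_mulC.
  rewrite [X in _ + X]/mxtrace big_ord1 -addrA; congr (_ + _).
  by rewrite mulr_natl mulrSr.
have dq := is_derive_mul dH (is_derive_inv dG G0).
have := @is_derive_comp_real R _ (real_root n.+1) (fun y => \det (H y) / \det (G y))
  a u^T _ _ (is_derive_real_root _ q0) dq.
move=> h; apply: is_derive_eq h _; rewrite tr /ratio_root.
have n0 : n.+1%:R != 0 :> R by rewrite pnatr_eq0.
move: (real_root _ _) (\tr _) => rho t.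
move: (n.+1%:R : R) n0 => m m0.
by field; rewrite m0 G0 H0.
Qed.

(** The Sinjukov equation: the covariant derivative of L along u is
    - u (phi L) - w (u^T G). *)
Definition tensor_derivative (u : 'cV[R]_n) : 'M[R]_n :=
  L a *m connection G a u - connection G a u *m L a
  - u *m (phi *m L a) - w *m (u^T *m G a).

Lemma is_derive_projective_tensor (u : 'cV[R]_n) :
  is_derive a u^T L (tensor_derivative u).
Proof.
have dG := is_derive_mx_direction u^T oU hG Ua.
have dV := is_derive_invmx u^T oU hH uH Ua.
rewrite trmxK !direction_metric // in dG dV.
have h := is_derive_scalemx (is_derive_ratio_root u) (is_derive_mulmx dV dG).
apply: is_derive_eq h _; rewrite connection_weyl.
set C := connection G a u; set p := (phi *m u) 0 0.
set rho := ratio_root a; set V := invmx (H a).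
have VH (X : 'M[R]_n) : X *m H a *m V = X by rewrite -mulmxA mulmxV ?uH // mulmx1.
have E : V *m ((C + p%:M + u *m phi)^T *m H a + H a *m (C + p%:M + u *m phi)) *m V =
   V *m C^T + C *m V + (2 * p) *: V + V *m phi^T *m u^T + u *m phi *m V.
  rewrite mulmxDr mulmxDl mulmxA VH mulKmx ?uH //.
  have -> : (C + p%:M + u *m phi)^T = C^T + p%:M + phi^T *m u^T.
    by rewrite linearD linearD /= tr_scalar_mx trmx_mul.
  rewrite !mulmxDr !mulmxDl mulmxA mul_mx_scalar mul_scalar_mx.
  move: (V *m C^T) (C *m V) (V *m phi^T *m u^T) (u *m phi *m V) => A1 A2 A3 A4.
  by apply/matrixP => k l; rewrite !mxE; ring.
rewrite E /tensor_derivative /projective_tensor -/rho -/V -/C.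
rewrite !(mulmxDl, mulmxDr, mulNmx, mulmxN, scalerDr, scalerN).
rewrite -?scalemxAr -?scalemxAl -?scalemxAr -?scalemxAl !mulmxA.
move: (V *m G a) (V *m C^T *m G a) (C *m V *m G a) (V *m phi^T *m u^T *m G a)
  (u *m phi *m V *m G a) (V *m G a *m C) => A1 A2 A3 A4 A5 A6.
by apply/matrixP => k l; rewrite !mxE; ring.
Qed.

Lemma connection_linear K : linear (connection K a).
Proof.
move=> s u v; apply/matrixP => k j; rewrite !mxE mulr_sumr -big_split /=.
by apply: eq_bigr => i _; rewrite !mxE; ring.
Qed.

Lemma tensor_derivative_linear : linear tensor_derivative.
Proof.
move=> s u v; rewrite /tensor_derivative connection_linear.
have -> : (s *: u + v)^T = s *: u^T + v^T by rewrite linearP.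
move: (L a) (w) (connection G a u) (connection G a v) => M W C D.
rewrite !mulmxDl !mulmxDr -!scalemxAr -!scalemxAl -!scalemxAr.
move: (M *m C) (M *m D) (C *m M) (D *m M) (u *m _) (v *m _) => A1 A2 A3 A4 A5 A6.
move: (W *m _) (W *m _) => A7 A8.
by apply/matrixP => k l; rewrite !mxE; ring.
Qed.

Lemma tensor_derivative_delta (u : 'cV[R]_n) :
  tensor_derivative u = \sum_k u k 0 *: tensor_derivative (delta_mx k 0).
Proof.
pose lin := GRing.isLinear.Build _ _ _ _ _ tensor_derivative_linear.
pose DL : {linear 'cV[R]_n -> 'M[R]_n} := HB.pack tensor_derivative lin.
have -> : tensor_derivative u = DL (\sum_k u k 0 *: delta_mx k 0).
  congr tensor_derivative; apply/colP => j; rewrite summxE (bigD1 j) //=.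
  rewrite !mxE !eqxx mulr1 big1 ?addr0 // => k kj.
  by rewrite !mxE eq_sym (negbTE kj) mulr0.
by rewrite linear_sum; apply: eq_bigr => k _; rewrite linearZ.
Qed.

(** L is the product of the inverse of H and G, up to a scalar factor. *)
Lemma tensor_selfadjoint : (G a *m L a)^T = G a *m L a.
Proof.
by rewrite /projective_tensor -scalemxAr linearZ /= !trmx_mul trmx_inv sG ?sH // mulmxA.
Qed.

(** The left-hand side is the Nijenhuis torsion of L.  By the Sinjukov equation it
    consists of connection terms, which cancel by the symmetry of the Christoffel
    symbols, of terms with phi, which cancel in pairs, and of a multiple of w,
    which is zero because L is selfadjoint. *)
Lemma nijenhuis (u v : 'cV[R]_n) :
  tensor_derivative (L a *m u) *m v - tensor_derivative (L a *m v) *m u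
  - L a *m (tensor_derivative u *m v - tensor_derivative v *m u) = 0.
Proof.
have symL : (L a)^T *m G a = G a *m L a.
  by rewrite -tensor_selfadjoint trmx_mul sG.
have CC x y := connectionC x y sG Ua.
rewrite /tensor_derivative; move: (L a) (w) (connection G a) symL CC => M W C symL CC.
pose beta (y : 'cV[R]_n) := (phi *m M *m y) 0 0.
pose b (x y : 'cV[R]_n) := (x^T *m G a *m y) 0 0.
have expand x y : (M *m C x - C x *m M - x *m (phi *m M) - W *m (x^T *m G a)) *m y =
    M *m (C x *m y) - C x *m (M *m y) - beta y *: x - b x y *: W.
  rewrite !mulmxBl -!mulmxA; congr (_ - _ - _ - _).
    by rewrite (mulmxA phi) (mx11_scalar (phi *m M *m y)) mul_mx_scalar.
  by rewrite (mulmxA x^T) (mx11_scalar (x^T *m G a *m y)) mul_mx_scalar.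
have bC x y : b x y = b y x.
  have -> : b x y = ((x^T *m G a *m y)^T) 0 0 by rewrite mxE.
  by rewrite !trmx_mul trmxK sG // mulmxA.
have bM x y : b (M *m x) y = b (M *m y) x.
  by rewrite [RHS]bC /b trmx_mul -(mulmxA x^T) symL !mulmxA.
rewrite !expand !mulmxBr -!scalemxAr.
rewrite (CC (M *m u) v) (CC (M *m v) u) (CC (M *m v) (M *m u)) (CC v u).
rewrite (bM v u) (bC v u).
move: (C v *m _) (C _ *m (M *m v)) (M *m (C u *m v)) => *.
by apply/matrixP => k l; rewrite !mxE; ring.
Qed.

End ProjectivelyRelated.

(** * Splitting along the kernels of the two factors *)

Section CommutingKernels.
Variables (R : realType) (n : nat).
Implicit Types (A B X : 'M[R]_n).

Lemma poly_mx_comm (p : {poly R}) A X : A *m X = X *m A ->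
  poly_mx p A *m X = X *m poly_mx p A.
Proof.
move=> AX; rewrite /poly_mx mulmx_suml mulmx_sumr; apply: eq_bigr => k _.
rewrite -scalemxAl -scalemxAr; congr (_ *: _).
exact/esym/(commrX (x := X) (y := A)).
Qed.

Local Notation e_ i := (delta_mx i 0 : 'cV[R]_n).

Lemma mulmx_delta m (A : 'M[R]_(m, n)) k i : (A *m e_ i) k 0 = A k i.
Proof. by rewrite -colE mxE. Qed.

Variables (P : pred 'I_n) (L Q1 Q2 : 'M[R]_n).
Hypotheses (LQ1 : L *m Q1 = Q1 *m L) (LQ2 : L *m Q2 = Q2 *m L).
Hypothesis (Q12 : Q1 *m Q2 = Q2 *m Q1).
Hypothesis ker1 : forall v : 'cV[R]_n,
  Q1 *m v = 0 <-> forall k, ~~ P k -> v k 0 = 0.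
Hypothesis ker2 : forall v : 'cV[R]_n,
  Q2 *m v = 0 <-> forall k, P k -> v k 0 = 0.

Lemma delta_ker1 i : P i -> Q1 *m e_ i = 0.
Proof.
by move=> Pi; apply/ker1 => k Pk; rewrite mxE; case: eqVneq Pk => // ->; rewrite Pi.
Qed.

Lemma delta_ker2 i : ~~ P i -> Q2 *m e_ i = 0.
Proof.
by move=> Pi; apply/ker2 => k Pk; rewrite mxE; case: eqVneq Pk => // ->; rewrite (negbTE Pi).
Qed.

Lemma block_diagonal i j : P i != P j -> L i j = 0.
Proof.
move=> Pij; rewrite -mulmx_delta; have [Pj|Pj] := boolP (P j).
  have /ker1 h : Q1 *m (L *m e_ j) = 0.
    by rewrite mulmxA -LQ1 -mulmxA delta_ker1 // mulmx0.
  by apply: h; move: Pij; rewrite Pj; case: (P i).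
have /ker2 h : Q2 *m (L *m e_ j) = 0.
  by rewrite mulmxA -LQ2 -mulmxA delta_ker2 // mulmx0.
by apply: h; move: Pij; rewrite (negbTE Pj); case: (P i).
Qed.

(** X Q2 = 0 because Q2 kills its kernel, the second space, and, commuting with
    Q1, maps the kernel of Q1, the first space, which X kills, into itself.
    So Q2 X = 0 as well: the columns of X, vectors of the first space, lie in
    the second. *)
Lemma sylvester_zero X : (forall j b, ~~ (P j && ~~ P b) -> X j b = 0) ->
  Q2 *m X = X *m Q2 -> X = 0.
Proof.
move=> X0 QX.
have XQ : X *m Q2 = 0.
  apply/matrixP => j b; rewrite -mulmx_delta -mulmxA [RHS]mxE.
  have [Pb|Pb] := boolP (P b); last by rewrite delta_ker2 // mulmx0 mxE.
  have /ker1 h : Q1 *m (Q2 *m e_ b) = 0.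
    by rewrite mulmxA Q12 -mulmxA delta_ker1 // mulmx0.
  rewrite mxE big1 // => k _; have [Pk|Pk] := boolP (P k); last by rewrite h // mulr0.
  by rewrite X0 ?mul0r // Pk andbF.
apply/matrixP => j b; rewrite mxE; have [Pj|Pj] := boolP (P j); last first.
  by rewrite X0 // (negbTE Pj).
have /ker2 h : Q2 *m (X *m e_ b) = 0 by rewrite mulmxA QX XQ mul0mx.
by rewrite -mulmx_delta h.
Qed.

End CommutingKernels.

Section LocalConstancy.
Variables (R : realType) (n : nat).

(** On a convex piece of V the function is constant along slices; hence the
    part of a connected set where it takes a given value is open and closed. *)
Lemma depends_only_on_derive (P : pred 'I_n) (V : set 'rV[R]_n) (f : 'rV[R]_n -> R) :
  open V ->
  (forall x (v : 'rV[R]_n), V x -> (forall k, P k -> v 0 k = 0) ->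
     is_derive x v f 0) ->
  depends_only_on P V f.
Proof.
move=> oV hf C CV cC slice x y Cx Cy.
have rad (p : 'rV[R]_n) : exists d : R, V p -> 0 < d /\ forall z, ball p d z -> V z.
  have [Vp|nVp] := pselect (V p); last by exists 0.
  have /nbhs_ballP[d /= d0 hd] := open_nbhs_nbhs (conj oV Vp).
  by exists d.
have [d hd] := choice rad.
have loc p z : C p -> C z -> ball p (d p) z -> f z = f p.
  move=> Cp Cz bz; have [d0 bV] := hd p (CV p Cp).
  have hv k : P k -> (z - p) 0 k = 0.
    by move=> Pk; rewrite !mxE (slice z p Cz Cp k Pk) subrr.
  have hder (t : R) : 0 <= t <= 1 -> is_derive (p + (t * 1) *: (z - p)) (z - p) f 0.
    move=> /andP[t0 t1]; apply: hf hv; apply: bV.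
    move: bz; rewrite -!ball_normE /= mulr1 opprD addrA subrr sub0r normrN normrZ.
    rewrite distrC ger0_norm // => bz; apply: le_lt_trans bz.
    by rewrite ler_piMl.
  have [t t01|t t01] := @mvt_line R _ f p (z - p) 1; first by have [] := hder t t01.
  have [_ ->] := hder t t01.
  have -> : p + 1 *: (z - p) = z by rewrite scale1r addrC subrK.
  by rewrite mulr0 => /eqP; rewrite subr_eq0 => /eqP.
pose B := [set z | C z /\ f z = f x].
(* Two points of C of which one lies in the ball of radius d around the
   other have the same value; so unions of such balls separate the level sets. *)
pose nb (E : set 'rV[R]_n) := \bigcup_(p in E) ball p (d p).
have onb E : open (nb E) by apply: bigcup_open => p _; exact: ball_open.
have BC : B = C.
  apply: cC; first by exists x.
    exists (nb B) => //; apply/seteqP; split=> z.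
      move=> Bz; split; first by case: Bz.
      by exists z => //; have [d0 _] := hd z (CV z Bz.1); exact: ballxx.
    by move=> [Cz [p [Cp fp] bz]]; split=> //; rewrite (loc p z).
  exists (~` nb (C `\` B)); first by apply: open_closedC.
  apply/seteqP; split=> z.
    move=> [Cz fz]; split=> // -[p [Cp nBp] bz]; apply: nBp; split=> //.
    by rewrite -(loc p z).
  move=> [Cz nz]; apply: contrapT => nBz; apply: nz; exists z => //.
  by have [d0 _] := hd z (CV z Cz); exact: ballxx.
by have [_ ->] : B y by rewrite BC.
Qed.

End LocalConstancy.

Section Splitting.
Variables (R : realType) (n : nat) (M : topologicalType).
Variable S : smooth_structure R n M.

(** Describes the distributions by equations rather than by generators. *)
Lemma coordinate_spanP (P : pred 'I_n) (v : 'cV[R]_n) :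
  coordinate_span P v <-> forall k, ~~ P k -> v k 0 = 0.
Proof.
split=> [[b ->] k Pk|h].
  rewrite summxE big1 // => i Pi; rewrite !mxE.
  by case: eqVneq Pi => [<-|_ _]; rewrite ?(negbTE Pk) //= mulr0.
exists (fun i => v i 0); apply/colP => k; rewrite summxE.
have [Pk|Pk] := boolP (P k); last first.
  rewrite h // big1 // => i Pi; rewrite !mxE.
  by case: eqVneq Pi => [<-|_ _]; rewrite ?(negbTE Pk) //= mulr0.
rewrite (bigD1 k) //= !mxE !eqxx mulr1 big1 ?addr0 // => i /andP[_ ik].
by rewrite !mxE eq_sym (negbTE ik) mulr0.
Qed.

Variables (g h : metric S) (c : chart R n M).
Hypotheses (gh : geodesics_among g h) (hc : coordinate_system S c).
Let U := chart_im c.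
Let L := associated_tensor g h c.
Variables (P : pred 'I_n) (p1 p2 : 'rV[R]_n -> {poly R}).
Hypothesis ker1 : forall x, U x -> forall v : 'cV[R]_n,
  poly_mx (p1 x) (L x) *m v = 0 <-> forall k, ~~ P k -> v k 0 = 0.
Hypothesis ker2 : forall x, U x -> forall v : 'cV[R]_n,
  poly_mx (p2 x) (L x) *m v = 0 <-> forall k, P k -> v k 0 = 0.

Lemma associated_tensor_block x i j : U x -> P i != P j -> L x i j = 0.
Proof.
move=> Ux; have comm p := poly_mx_comm p (erefl (L x *m L x)).
exact: (block_diagonal (esym (comm _)) (esym (comm _)) (ker1 Ux) (ker2 Ux)).
Qed.

(** The i-th column is fixed; X collects the derivatives of its entries in P along
    the coordinates outside of P, and L X = X L is the torsion identity for the
    basis vectors e_i and e_b, read off in the rows of P. *)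
Lemma associated_tensor_splits i j : P i -> P j ->
  depends_only_on P U (fun x => L x j i).
Proof.
move=> Pi Pj; have oU : open U := @chart_im_open _ _ _ c.
apply: depends_only_on_derive => // a v Ua vP.
have [phi hphi] := weyl gh hc Ua.
have hg := metric_Ck_mx g 1 hc; have hh := metric_Ck_mx h 1 hc.
have sg := Defs.metric_sym g hc; have sh := Defs.metric_sym h hc.
have ug := metric_nondeg g hc; have uh := metric_nondeg h hc.
pose DL := tensor_derivative (g c) (h c) a phi.
have dL (u : 'cV[R]_n) : is_derive a u^T L (DL u).
  exact: (is_derive_projective_tensor oU hg hh sg sh ug uh Ua hphi).
have nij u v' : DL (L a *m u) *m v' - DL (L a *m v') *m u
    - L a *m (DL u *m v' - DL v' *m u) = 0.
  exact: (nijenhuis (H := h c) oU sg sh Ua phi).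
have DLE u : DL u = \sum_k u k 0 *: DL (delta_mx k 0).
  exact: tensor_derivative_delta.
(* The off-diagonal blocks vanish on all of U, hence so do their
   derivatives. *)
have off k l u : P k != P l -> DL u k l = 0.
  move=> Pkl; have /is_derive_mxP /(_ k l) [_ <-] := dL u.
  rewrite (near_eq_derive (g := cst 0)) ?derive_cst //.
  by apply: (open_near oU Ua) => y Uy; exact: associated_tensor_block.
pose e_ (b : 'I_n) : 'cV[R]_n := delta_mx b 0.
pose X : 'M[R]_n := \matrix_(m, b) if P m && ~~ P b then DL (e_ b) m i else 0.
have X0 m b : ~~ (P m && ~~ P b) -> X m b = 0 by rewrite mxE => /negbTE ->.
have LX : L a *m X = X *m L a.
  apply/matrixP => m b; rewrite !mxE.
  have [/andP[Pm Pb]|Pmb] := boolP (P m && ~~ P b); last first.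
    rewrite big1 ?big1 // => k _.
      have [Pmk|Pmk] := boolP (P m && ~~ P k); last by rewrite X0 // mul0r.
      have Pkb : P k != P b.
        by move: Pmb Pmk; case: (P m); case: (P k); case: (P b).
      by rewrite associated_tensor_block ?mulr0.
    have [Pkb|Pkb] := boolP (P k && ~~ P b); last by rewrite X0 // mulr0.
    have Pmk : P m != P k.
      by move: Pmb Pkb; case: (P m); case: (P k); case: (P b).
    by rewrite associated_tensor_block ?mul0r.
  have := nij (e_ i) (e_ b) => /matrixP /(_ m 0).
  have t1 : (DL (L a *m e_ i) *m e_ b) m 0 = 0.
    by rewrite mulmx_delta off // Pm (negbTE Pb).
  have t2 : (DL (L a *m e_ b) *m e_ i) m 0 = \sum_k X m k * L a k b.
    rewrite mulmx_delta DLE summxE; apply: eq_bigr => k _.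
    rewrite mulmx_delta [LHS]mxE [X m k]mxE Pm /=.
    have [Pk|Pk] := boolP (P k); last by rewrite mulrC.
    by rewrite (@associated_tensor_block a k b) ?Pk ?(negbTE Pb) // !mul0r.
  have t3 : (L a *m (DL (e_ i) *m e_ b)) m 0 = 0.
    rewrite mxE big1 // => k _; rewrite mulmx_delta.
    have [Pk|Pk] := boolP (P k); first by rewrite off ?mulr0 // Pk (negbTE Pb).
    by rewrite (@associated_tensor_block a m k) ?mul0r // Pm (negbTE Pk).
  have t4 : (L a *m (DL (e_ b) *m e_ i)) m 0 = \sum_k L a m k * X k b.
    rewrite mxE; apply: eq_bigr => k _; rewrite mulmx_delta [X k b]mxE Pb andbT.
    case: ifPn => // Pk.
    by rewrite (@associated_tensor_block a m k) ?mul0r // Pm (negbTE Pk).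
  rewrite mulmxBr.
  set T1 := DL _ *m _ in t1 *; set T2 := DL _ *m _ in t2 *.
  set T3 := L a *m (DL _ *m _) in t3 *; set T4 := L a *m (DL _ *m _) in t4 *.
  have sub (A B : 'cV[R]_n) : (A - B) m 0 = A m 0 - B m 0 by rewrite !mxE.
  rewrite !sub t1 t2 t3 t4 [X in _ = X -> _]mxE => E.
  by move: E; rewrite !sub0r opprK addrC => /eqP; rewrite subr_eq0 => /eqP.
have X_eq0 : X = 0.
  have comm p := poly_mx_comm p (erefl (L a *m L a)).
  apply: (sylvester_zero _ (ker1 Ua) (ker2 Ua)) => //.
    exact: poly_mx_comm.
  exact: poly_mx_comm.
have /is_derive_mxP /(_ j i) := dL v^T.
rewrite trmxK => d; apply: is_derive_eq d _.
rewrite DLE summxE big1 // => k _; rewrite mxE.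
have [Pk|Pk] := boolP (P k); first by rewrite mxE vP // mul0r.
have /matrixP /(_ j k) := X_eq0; rewrite !mxE Pj Pk /= => ->.
by rewrite mulr0.
Qed.

End Splitting.

Theorem theorem2 (R : realType) (n : nat) (M : topologicalType)
  (S : smooth_structure R n M) (g gbar : metric S)
  (hequiv : geodesically_equivalent g gbar)
  (hL : associated_tensor_defined g gbar)
  (chi1 chi2 : M -> {poly R}) (r : nat)
  (hchi : admissible_factorisation g gbar chi1 chi2 r)
  (c : chart R n M) (hc : coordinate_system S c)
  (hD1 : forall x, chart_im c x ->
    kernel_distribution g gbar chi1 c x
      = coordinate_span (fun i : 'I_n => (i < r)%N))
  (hD2 : forall x, chart_im c x ->
    kernel_distribution g gbar chi2 c x
      = coordinate_span (fun i : 'I_n => (r <= i)%N)) :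
  let L := associated_tensor g gbar c in
  [/\ forall x, chart_im c x -> forall i j : 'I_n,
        (i < r)%N != (j < r)%N -> L x i j = 0,
      forall i j : 'I_n, (i < r)%N -> (j < r)%N ->
        depends_only_on (fun k : 'I_n => (k < r)%N) (chart_im c)
          (fun x => L x i j) &
      forall i j : 'I_n, (r <= i)%N -> (r <= j)%N ->
        depends_only_on (fun k : 'I_n => (r <= k)%N) (chart_im c)
          (fun x => L x i j)].
Proof.
move=> L; have [gh _] := hequiv.
have ker (chi : M -> {poly R}) (P : pred 'I_n) :
    (forall x, chart_im c x ->
       kernel_distribution g gbar chi c x = coordinate_span P) ->
    forall x, chart_im c x -> forall v : 'cV[R]_n,
      poly_mx (chi (chart_inv c x)) (L x) *m v = 0 <-> forall k, ~~ P k -> v k 0 = 0.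
  by move=> hD x cx v; rewrite -coordinate_spanP -(hD x cx).
have ker1 := ker _ _ hD1; have ker2 := ker _ _ hD2.
have ker1' x : chart_im c x -> forall v : 'cV[R]_n,
    poly_mx (chi1 (chart_inv c x)) (L x) *m v = 0 <->
    forall k : 'I_n, (r <= k)%N -> v k 0 = 0.
  by move=> cx v; rewrite ker1 //; split=> h k kr; apply: h; move: kr; rewrite -leqNgt.
have ker2' x : chart_im c x -> forall v : 'cV[R]_n,
    poly_mx (chi2 (chart_inv c x)) (L x) *m v = 0 <->
    forall k : 'I_n, (k < r)%N -> v k 0 = 0.
  by move=> cx v; rewrite ker2 //; split=> h k kr; apply: h; move: kr; rewrite -ltnNge.
split.
- move=> x cx i j; exact: associated_tensor_block ker1 ker2' x i j cx.
- move=> i j ir jr; exact: (associated_tensor_splits gh hc ker1 ker2' jr ir).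
- move=> i j ir jr; exact: (associated_tensor_splits gh hc ker2 ker1' jr ir).
Qed.
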